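(* There is an absolute constant $c>0$ such that every connected vertex-transitive graph on $n\geq 3$ vertices contains a cycle of length at least $c\, n^{13/21}$.
   Context: The paper states this as ''a cycle of length at least $\Omega(n^{13/21})$''; graphs are finite and simple, and the length of a cycle is its number of edges (equivalently, vertices). *)

(* Defs.v *)
From mathcomp Require Import all_boot all_fingroup.

Set Implicit Arguments.
Unset Strict Implicit.
Unset Printing Implicit Defensive.

(* A finite simple graph on the vertex set T is given by its adjacency relation
   e : rel T. *)
Definition simple_graph (T : finType) (e : rel T) : Prop :=
  symmetric e /\ irreflexive e.

Definition connected_graph (T : finType) (e : rel T) : Prop :=
  0 < #|T| /\ forall x y : T, connect e x y.

Definition graph_automorphism (T : finType) (e : rel T) (f : {perm T}) : Prop :=
  forall x y : T, e (f x) (f y) = e x y.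

Definition vertex_transitive (T : finType) (e : rel T) : Prop :=
  forall x y : T, exists2 f : {perm T}, graph_automorphism e f & f x = y.

(* [ucycle e s] also holds of the empty sequence and of [:: x; y] for an edge
   xy, which are not cycles of a simple graph; hence the bound on size s. The
   length of the cycle is size s. *)
Definition graph_cycle (T : finType) (e : rel T) (s : seq T) : Prop :=
  2 < size s /\ ucycle e s.

(* Main.v *)
(* Let C be a longest cycle, of length L, in a graph on n vertices. Averaging over the automorphism
   group gives an automorphic image D of C with k := |C :&: D| <= L^2 / n. By Menger's theorem a
   minimum separator S of C and D has as many vertices as there are disjoint C-D paths. Any longest
   cycle meets both C and D, hence S, and averaging again gives n <= L |S|; so it suffices to show
   |S| = O(k^(8/5)).

   The common vertices cut C and D into O(k) segments each, and the disjoint C-D paths are the edges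
   of a bipartite graph between segments of C and segments of D. Exchanging the parts of the segments
   delimited by suitable paths turns C and D into cycles of larger total length; this excludes
   multiple edges, 4-cycles whose edges leave opposite segments in the same order, and cubes
   satisfying certain order constraints. If there are many edges, then for some u and v there are
   many edges between the neighbours of v and the neighbours of u (Erdos and Simonovits). Restrict to
   those having a fixed position with respect to u and v: the first exclusion forces the order on all
   segments to be the reverse of the one on u and v, so there is no 4-cycle, and counting paths of
   length 3 produces two such paths with the same ends and similar orders, hence a hexagon that
   forms an excluded cube together with u and v. *)
Require Import Defs.
From mathcomp Require Import fingroup perm.
From mathcomp Require Import all_boot all_order all_algebra.
From mathcomp Require Import reals exp.
From mathcomp Require Import boolp zify ring lra.

Set Implicit Arguments.
Unset Strict Implicit.
Unset Printing Implicit Defensive.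

Import Order.TTheory GRing.Theory Num.Theory.

(** * Rerouting two subdivided cycles *)

Lemma uniq_flatten_map (I T : eqType) (f : I -> seq T) (s : seq I) :
  uniq s -> {in s, forall i, uniq (f i)} ->
  {in s &, forall i j, i != j -> ~~ has [in f i] (f j)} ->
  uniq (flatten [seq f i | i <- s]).
Proof.
elim: s => //= i s IHs /andP[i_s s_uniq] f_uniq f_disj.
rewrite cat_uniq f_uniq ?mem_head // IHs ?andbT //=; last 2 first.
- by move=> j j_s; apply: f_uniq; rewrite inE j_s orbT.
- by move=> j l j_s l_s; apply: f_disj; rewrite inE ?j_s ?l_s orbT.
apply/hasPn => t /flatten_mapP[j j_s t_j]; apply/negP => t_i.
have ij : i != j by apply: contraNneq i_s => ->.
have /hasPn/(_ t t_j) := f_disj i j (mem_head _ _) (mem_behead (s := i :: s) j_s) ij.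
by rewrite /= t_i.
Qed.

Lemma flatten_map_uniq_disjoint (I T : eqType) (f : I -> seq T) (s : seq I) :
  uniq (flatten [seq f i | i <- s]) ->
  {in s, forall i, uniq (f i)} /\
  {in s &, forall i j t, t \in f i -> t \in f j -> i = j}.
Proof.
elim: s => [|i s IHs] //=; rewrite cat_uniq => /and3P[fi_uniq /hasPn fi_disj].
move/IHs=> [f_uniq f_disj]; split=> [j|j l].
  by rewrite inE => /predU1P[->|/f_uniq].
have aux j' t : j' \in s -> t \in f j' -> t \in f i -> False.
  by move=> j's tj' /(negP (fi_disj t _)); apply; apply/flatten_mapP; exists j'.
rewrite !inE => /predU1P[->|js] /predU1P[->|ls] // t tj tl.
- by case: (aux l t).
- by case: (aux j t).
- exact: f_disj tj tl.
Qed.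

Lemma uniq_map_inj (I T : eqType) (f : I -> T) (s : seq I) :
  uniq (map f s) -> {in s &, injective f}.
Proof.
elim: s => //= i s IHs /andP[fi /IHs{}IHs] j l; rewrite !inE.
case/predU1P=> [->|js] /predU1P[->|ls] // eq_f; last exact: IHs.
- by rewrite eq_f map_f in fi.
- by rewrite -eq_f map_f in fi.
Qed.

Lemma leq_sum_uniq_subset (I : eqType) (l : I -> nat) (s1 s2 : seq I) :
  uniq s1 -> {subset s1 <= s2} ->
  \sum_(i <- s1) l i <= \sum_(i <- s2) l i.
Proof.
elim: s1 s2 => [|i s1 IHs] s2 /=; first by rewrite big_nil.
move=> /andP[i_s1 s1_uniq] sub; have i_s2 : i \in s2 by rewrite sub ?mem_head.
rewrite big_cons (perm_big _ (perm_to_rem i_s2)) big_cons leq_add2l IHs // => j j_s1.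
have ji : j != i by apply: contraNneq i_s1 => <-.
by have := sub j (mem_behead (s := i :: s1) j_s1); rewrite (perm_mem (perm_to_rem i_s2)) inE (negPf ji).
Qed.

Section Exchange.

Variables (J : eqType) (s : bool -> seq J).

Notation node := (bool * J)%type.
Notation cell := (node + J)%type.
Notation dart := (bool * cell)%type.

(* A node [(b, j)] is the end on cycle [b] of path [j]. A dart [(o, k)] traverses, forwards iff [o],
   the arc of cycle [b] following node [(b, j)] if [k = inl (b, j)], and the path [j] (forwards
   meaning from cycle [false] to cycle [true]) if [k = inr j]. *)
Definition dart_src (d : dart) : node :=
  match d.2 with
  | inl x => if d.1 then x else (x.1, next (s x.1) x.2)
  | inr j => (~~ d.1, j)
  end.

Definition dart_tgt (d : dart) : node := dart_src (~~ d.1, d.2).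

Definition cell_known (k : cell) : bool :=
  match k with
  | inl x => x.2 \in s x.1
  | inr j => (j \in s false) && (j \in s true)
  end.

(* [inner] lists the arcs that contain no common vertex of the two cycles: a rerouting of cycle [b]
   may use only these arcs of the other cycle. *)
Definition cell_fits (inner : seq node) (b : bool) (k : cell) : bool :=
  if k is inl x then (x.1 == b) || (x \in inner) else true.

Definition dart_cycle (inner : seq node) (b : bool) (ds : seq dart) : bool :=
  [&& 2 < size ds, cycle (fun d d' => dart_tgt d == dart_src d') ds,
      uniq [seq dart_src d | d <- ds], uniq [seq d.2 | d <- ds]
    & all (fun d => cell_known d.2 && cell_fits inner b d.2) ds].

(* The two new cycles cover every arc of the given ones and use a path, so they are longer in total. *)
Definition exchange (inner : seq node) (ds : bool -> seq dart) : bool :=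
  let ks := [seq d.2 | d <- ds false ++ ds true] in
  [&& dart_cycle inner false (ds false), dart_cycle inner true (ds true),
      all (fun b => all (fun j => inl (b, j) \in ks) (s b)) [:: false; true]
    & has (fun k => if k is inr _ then true else false) ks].

Variables (T : eqType) (e : rel T).
Hypothesis e_sym : symmetric e.
Variables (phi : node -> T) (w : node -> seq T) (P : J -> seq T).

Definition subdivided_cycle b := flatten [seq phi (b, j) :: w (b, j) | j <- s b].

Variable inner : seq node.

Hypothesis s_uniq : forall b, uniq (s b).
Hypothesis cyc_uniq : forall b, uniq (subdivided_cycle b).
Hypothesis cyc_cycle : forall b, cycle e (subdivided_cycle b).
Hypothesis phi_private : forall b j, j \in s b -> phi (b, j) \notin subdivided_cycle (~~ b).
Hypothesis inner_private : forall b j t,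
  (b, j) \in inner -> t \in w (b, j) -> t \notin subdivided_cycle (~~ b).
Hypothesis P_path : forall j, j \in s false ->
  path e (phi (false, j)) (rcons (P j) (phi (true, j))).
Hypothesis P_uniq : forall j, j \in s false -> uniq (P j).
Hypothesis P_private : forall b j t, j \in s false -> t \in P j -> t \notin subdivided_cycle b.
Hypothesis P_disjoint : forall i j t,
  i \in s false -> j \in s false -> t \in P i -> t \in P j -> i = j.

Definition cell_interior (k : cell) : seq T :=
  match k with inl x => w x | inr j => P j end.

Definition dart_interior (d : dart) : seq T :=
  if d.1 then cell_interior d.2 else rev (cell_interior d.2).

Definition dart_lift (d : dart) : seq T := phi (dart_src d) :: dart_interior d.

Let mem_interior d : dart_interior d =i cell_interior d.2.
Proof. by rewrite /dart_interior; case: d.1 => // t; rewrite mem_rev. Qed.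

Lemma arc_path b j : j \in s b ->
  path e (phi (b, j)) (rcons (w (b, j)) (phi (b, next (s b) j))).
Proof.
move=> js; case/rot_to: (js) => i s' rots.
have := cyc_cycle b; rewrite /subdivided_cycle.
have [i'] : exists i', rot i' (subdivided_cycle b) =
    flatten [seq phi (b, j) :: w (b, j) | j <- j :: s'].
  rewrite -rots /subdivided_cycle map_rot /rot.
  set ss := map _ _; exists (size (flatten (take i ss))).
  have -> : flatten ss = flatten (take i ss) ++ flatten (drop i ss).
    by rewrite -flatten_cat cat_take_drop.
  by rewrite drop_size_cat // take_size_cat // flatten_cat.
move=> rotc; rewrite -/(subdivided_cycle b) -(rot_cycle i') rotc /=.
rewrite -(next_rot i (s_uniq b)) rots /=.
case: (s') => [|j' s''] /=; rewrite eqxx; first by rewrite cats0.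
by rewrite -cat_rcons rcons_cat cat_path => /andP[].
Qed.

Lemma dart_path d : cell_known d.2 ->
  path e (phi (dart_src d)) (rcons (dart_interior d) (phi (dart_tgt d))).
Proof.
have fwd k : cell_known k ->
    path e (phi (dart_src (true, k))) (rcons (cell_interior k) (phi (dart_tgt (true, k)))).
  case: k => [[b j]|j] /= known; first exact: arc_path.
  by apply: P_path; case/andP: known.
case: d => [[] k] /= known; first exact: fwd.
have := fwd k known; rewrite /dart_tgt /dart_interior /=.
rewrite -rev_path last_rcons belast_rcons rev_cons.
by rewrite (eq_path (e' := e)).
Qed.

Lemma dart_walk d ds :
  path (fun d d' => dart_tgt d == dart_src d') d ds ->
  all (fun d => cell_known d.2) (d :: ds) ->
  path e (phi (dart_src d))
    (rcons (dart_interior d ++ flatten (map dart_lift ds)) (phi (dart_tgt (last d ds)))).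
Proof.
elim: ds d => [|d' ds IHds] d /=; first by rewrite cats0 andbT => _; apply: dart_path.
case/andP=> /eqP dd' /IHds{}IHds /and3P[d_k d'_k ds_k].
rewrite rcons_cat /= -cat_rcons cat_path -{1}dd' dart_path //= last_rcons.
by apply: IHds; rewrite /= d'_k.
Qed.

Lemma cyc_atoms b :
  [/\ {in s b &, injective (fun j => phi (b, j))},
      {in s b &, forall i j, phi (b, i) \notin w (b, j)},
      {in s b, forall j, uniq (w (b, j))} &
      {in s b &, forall i j t, t \in w (b, i) -> t \in w (b, j) -> i = j}].
Proof.
have [block_uniq block_disj] := flatten_map_uniq_disjoint (cyc_uniq b).
split.
- by move=> i j i_s j_s eq_ij; apply: block_disj (mem_head _ _) _ => //; rewrite eq_ij mem_head.
- move=> i j i_s j_s; apply/negP => ij.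
  have eq_ij : i = j.
    by apply: block_disj (mem_head _ _) _ => //; rewrite inE ij orbT.
  by have := block_uniq i i_s; rewrite /= {2}eq_ij ij.
- by move=> j /block_uniq /andP[].
- move=> i j i_s j_s t ti tj.
  by apply: (block_disj i j i_s j_s t); rewrite inE ?ti ?tj orbT.
Qed.

Lemma phi_mem b j : j \in s b -> phi (b, j) \in subdivided_cycle b.
Proof. by move=> js; apply/flatten_mapP; exists j => //; apply: mem_head. Qed.

Lemma w_mem b j t : j \in s b -> t \in w (b, j) -> t \in subdivided_cycle b.
Proof. by move=> js tj; apply/flatten_mapP; exists j; rewrite // inE tj orbT. Qed.

Lemma node_interior_disjoint b x k :
  x.2 \in s x.1 -> cell_known k -> cell_fits inner b k -> phi x \notin cell_interior k.
Proof.
case: x => bx i /= i_s; case: k => [[b' j]|j] /=; last first.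
  case/andP=> js _ _; apply: contraL (phi_mem i_s) => ?.
  exact: P_private js _.
move=> js _; case: (eqVneq bx b') => [->|nb] in i_s *.
  by case: (cyc_atoms b') => _ disj _ _; apply: disj; rewrite // -?nb.
by apply: contraNN (phi_private i_s) => tj; have := w_mem js tj; case: (bx) (b') nb => [] [].
Qed.

Lemma interior_disjoint b k k' t :
  cell_known k -> cell_known k' -> cell_fits inner b k -> cell_fits inner b k' ->
  t \in cell_interior k -> t \in cell_interior k' -> k = k'.
Proof.
case: k k' => [[b1 i]|i] [[b2 j]|j] /= ki kj fi fj ti tj.
- case: (eqVneq b1 b2) => [eb|nb].
    by subst b2; case: (cyc_atoms b1) => _ _ _ disj; rewrite (disj _ _ ki kj t).
  have: ((b1, i) \in inner) || ((b2, j) \in inner).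
    by apply: contraNT nb => /norP[/negPf in1 /negPf in2]; move: fi fj;
       rewrite in1 in2 !orbF => /eqP-> /eqP->.
  case/orP => /inner_private; [move/(_ _ ti)|move/(_ _ tj)].
    by have := w_mem kj tj; case: (b1) (b2) nb => [] [] //= _ ->.
  by have := w_mem ki ti; case: (b1) (b2) nb => [] [] //= _ ->.
- by case/andP: kj => js _; have := P_private b1 js tj; rewrite (w_mem ki ti).
- by case/andP: ki => js _; have := P_private b2 js ti; rewrite (w_mem kj tj).
- by case/andP: ki kj => is_ _ /andP[js _]; rewrite (P_disjoint is_ js ti tj).
Qed.

Lemma src_known d : cell_known d.2 -> (dart_src d).2 \in s (dart_src d).1.
Proof.
case: d => o [[b j]|j] /=; first by case: o => //= js; rewrite mem_next.
by case: o => /= /andP[].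
Qed.

Lemma phi_inj x y : x.2 \in s x.1 -> y.2 \in s y.1 -> phi x = phi y -> x = y.
Proof.
case: x y => [b i] [b' j] /= is_ js eq_phi; case: (eqVneq b b') => [eb|nb].
  by subst b'; case: (cyc_atoms b) => inj _ _ _; rewrite (inj _ _ is_ js eq_phi).
have := phi_private is_; rewrite eq_phi.
by have := phi_mem js; case: (b) (b') nb => [] [] //= _ ->.
Qed.

Lemma dart_cycle_lift b ds : dart_cycle inner b ds ->
  let z := flatten (map dart_lift ds) in
  [/\ 2 < size z, ucycle e z &
      size z = \sum_(k <- [seq d.2 | d <- ds]) (size (cell_interior k)).+1].
Proof.
case/and5P=> ds_gt2 ds_cyc src_uniq cell_uniq ds_ok.
have known d : d \in ds -> cell_known d.2 by case/(allP ds_ok)/andP.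
have fits d : d \in ds -> cell_fits inner b d.2 by case/(allP ds_ok)/andP.
have sz : size (flatten (map dart_lift ds)) =
    \sum_(k <- [seq d.2 | d <- ds]) (size (cell_interior k)).+1.
  rewrite size_flatten /shape -map_comp sumnE !big_map; apply: eq_bigr => -[o k] _.
  by rewrite /= /dart_interior; case: o; rewrite //= size_rev.
split=> //.
- rewrite sz; apply: leq_trans ds_gt2 _; rewrite big_map -sum1_size.
  by apply: leq_sum.
- apply/andP; split.
    case: ds ds_cyc known {ds_gt2 src_uniq cell_uniq ds_ok fits sz} => //= d ds ds_cyc known.
    have: path (fun d d' => dart_tgt d == dart_src d') d ds /\
        dart_tgt (last d ds) = dart_src d.
      by move: ds_cyc; rewrite rcons_path => /andP[-> /eqP].
    by case=> /dart_walk walk tgt_last; move: walk; rewrite tgt_last; apply; apply/allP.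
  apply: uniq_flatten_map => [|d dds|d d' dds d'ds dd'].
  + exact: map_uniq src_uniq.
  + rewrite /dart_lift /= mem_interior (node_interior_disjoint _ (known d dds) (fits d dds)).
      rewrite /dart_interior; have: uniq (cell_interior d.2).
        have := known d dds; case: d.2 => [[b' j]|j] /=; last by case/andP => /P_uniq.
        by case: (cyc_atoms b') => _ _ wu _; apply: wu.
      by case: d.1; rewrite ?rev_uniq.
    exact/src_known/known.
  + have src_neq : dart_src d != dart_src d'.
      by apply: contraNneq dd' => /(uniq_map_inj src_uniq)->.
    have cell_neq : d.2 != d'.2.
      by apply: contraNneq dd' => /(uniq_map_inj cell_uniq)->.
    apply/hasPn => t; rewrite /= !inE !mem_interior.
    case/predU1P=> [->|td']; apply/negP => /predU1P[|].
    * by move/phi_inj => eq_src; rewrite eq_src ?src_known ?known ?eqxx in src_neq.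
    * apply/negP; apply: (node_interior_disjoint _ (known d dds) (fits d dds)).
      exact/src_known/known.
    * move=> td; move: td'; rewrite td; apply/negP.
      apply: (node_interior_disjoint _ (known d' d'ds) (fits d' d'ds)).
      exact/src_known/known.
    * move=> td; case/eqP: cell_neq.
      exact: interior_disjoint (known d dds) (known d' d'ds) (fits d dds) (fits d' d'ds) td td'.
Qed.

Lemma exchange_longer ds : exchange inner ds ->
  exists z z' : seq T, [/\ 2 < size z, ucycle e z, 2 < size z', ucycle e z' &
    size (subdivided_cycle false) + size (subdivided_cycle true) < size z + size z'].
Proof.
case/and4P=> /dart_cycle_lift[z_gt2 z_cyc sz] /dart_cycle_lift[z'_gt2 z'_cyc sz'] cover.
case/hasP=> -[//|j0] j0_ks _.
exists (flatten (map dart_lift (ds false))), (flatten (map dart_lift (ds true))); split=> //.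
rewrite sz sz' -big_cat -map_cat.
have size_cyc b : size (subdivided_cycle b) =
    \sum_(k <- [seq inl (b, j) | j <- s b]) (size (cell_interior k)).+1.
  by rewrite size_flatten /shape -map_comp sumnE !big_map.
rewrite !size_cyc -big_cat.
pose arcs : seq cell := [seq inl (false, j) | j <- s false] ++ [seq inl (true, j) | j <- s true].
have sub : {subset inr j0 :: arcs <= [seq d.2 | d <- ds false ++ ds true]}.
  move: cover => /= /and3P[/allP cov0 /allP cov1 _] k; rewrite inE mem_cat.
  by case/predU1P=> [->//|/orP[]/mapP[j js ->]]; [apply: cov0|apply: cov1].
apply: leq_trans (leq_sum_uniq_subset _ _ sub); first by rewrite big_cons addSn ltnS leq_addl.
rewrite /= mem_cat !cat_uniq !map_inj_uniq ?s_uniq ?andbT; try by move=> i j [].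
apply/andP; split; first by apply/norP; split; apply/mapP => -[].
by apply/hasPn => _ /mapP[j _ ->]; apply/mapP => -[].
Qed.

End Exchange.

Section Trace.

Variables (J : eqType) (s : bool -> seq J) (F : seq J).

(* Along each segment, the arcs used by the rerouting of cycle [b] alternate at the ends of the
   paths in [F]; they include the arcs between segments exactly on cycle [b]. *)
Definition arc_kept (b : bool) (x : bool * J) : bool :=
  odd (count [in F] (take (index x.2 (s x.1)).+1 (s x.1))) == (x.1 != b).

Definition dart_next (b : bool) (d : bool * (bool * J + J)) : bool * (bool * J + J) :=
  let x := dart_tgt s d in
  let before := (x.1, prev (s x.1) x.2) in
  if (if d.2 is inl _ then x.2 \in F else false) then (~~ x.1, inr x.2)
  else if (if d.2 is inl _ then d.1 else arc_kept b x) then (true, inl x)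
  else (false, inl before).

Fixpoint trace_from (n : nat) (b : bool) (d0 d : bool * (bool * J + J)) :=
  d :: if n is n'.+1 then
         let d' := dart_next b d in if d' == d0 then [::] else trace_from n' b d0 d'
       else [::].

Definition trace (b : bool) : seq (bool * (bool * J + J)) :=
  if rev (s b) is j :: _ then
    trace_from (3 * size (s b)) b (true, inl (b, j)) (true, inl (b, j))
  else [::].

End Trace.

Definition two_sided (s1 s2 : seq nat) (b : bool) := if b then s2 else s1.

Lemma disjoint_exchange :
  let s := two_sided [:: 0; 1] [:: 0; 1] in
  exchange s [seq (b, j) | b <- [:: false; true], j <- [:: 0; 1]] (trace s [:: 0; 1]).
Proof. by vm_compute. Qed.

Lemma digon_exchange (o : bool) :
  let s := two_sided [:: 0; 1] (if o then [:: 0; 1] else [:: 1; 0]) in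
  exchange s [:: (false, 0); (true, ~~ o : nat)] (trace s [:: 0; 1]).
Proof. by case: o; vm_compute. Qed.

Lemma quad_exchange :
  let s := two_sided [:: 0; 1; 2; 3] [:: 0; 2; 1; 3] in
  exchange s [:: (false, 0); (false, 2); (true, 0); (true, 1)] (trace s [:: 0; 1; 2; 3]).
Proof. by vm_compute. Qed.

Definition edge_label (i j : nat) := 4 * i + j.

(* The cube is K_{4,4} minus a perfect matching: segment [i] of one cycle and segment [j] of the other
   are joined iff [i != j], and u, v are the segments numbered [0]. [ord] is the order of the paths
   on segment u; on the other segments it is reversed, with the path to v first iff [t]. *)
Definition cube_side (label : nat -> nat -> nat) (seg ord : seq nat) (t : bool) : seq nat :=
  [seq label 0 j | j <- ord] ++
  flatten [seq (if t then [:: label i 0] else [::]) ++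
               [seq label i j | j <- rev ord & j != i] ++
               (if t then [::] else [:: label i 0]) | i <- seg].

Definition cube_cyclic (seg1 ord1 seg2 ord2 : seq nat) (t1 t2 : bool) (b : bool) : seq nat :=
  if b then cube_side (fun j i => edge_label i j) seg2 ord2 t2
  else cube_side edge_label seg1 ord1 t1.

Definition seg_of (b : bool) (l : nat) := if b then l %% 4 else l %/ 4.

Definition cube_inner (s : bool -> seq nat) : seq (bool * nat) :=
  [seq (b, l) | b <- [:: false; true], l <- [seq l <- s b | seg_of b l == seg_of b (next (s b) l)]].

(* Found by computer: for each arrangement enumerated in [cube_check], one of these even subgraphs of
   the cube reroutes both cycles into single cycles. *)
Definition cube_subgraphs : seq (seq nat) :=
  [:: [:: 2; 3; 4; 6; 8; 11];
      [:: 2; 3; 4; 7; 12; 14];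
      [:: 1; 2; 8; 9; 12; 14];
      [:: 1; 3; 8; 11; 12; 13];
      [:: 1; 3; 4; 6; 9; 11; 12; 14];
      [:: 1; 2; 4; 7; 8; 11; 13; 14];
      [:: 6; 7; 9; 11; 13; 14];
      [:: 6; 7; 8; 11; 12; 14];
      [:: 4; 6; 8; 9; 13; 14];
      [:: 4; 7; 9; 11; 12; 13]].

(* The orders in which 1 is not in the middle: without this restriction there are arrangements of the
   cube that admit no exchange. *)
Definition end1_orders := [:: [:: 1; 2; 3]; [:: 1; 3; 2]; [:: 2; 3; 1]; [:: 3; 2; 1]].

Definition cube_labels : seq nat := [seq l <- iota 0 16 | l %/ 4 != l %% 4].

Definition cube_side_ok (b : bool) (l : seq nat) : bool :=
  perm_eq l cube_labels &&
  all (fun r => seg_of b (last 0 (rot r l)) != seg_of b (head 0 (rot r l))) [:: 0; 3].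

Definition cube_check : bool :=
  all (fun segs1 => all (fun ord1 => all (fun segs2 => all (fun ord2 =>
   all (fun t1 => all (fun t2 =>
    let s := cube_cyclic segs1 ord1 segs2 ord2 t1 t2 in
    [&& cube_side_ok false (s false), cube_side_ok true (s true) &
        has (fun F => exchange s (cube_inner s) (trace s F)) cube_subgraphs])
    [:: false; true]) [:: false; true]) end1_orders) end1_orders) end1_orders)
    [:: [:: 1; 2; 3]; [:: 2; 3; 1]].

Lemma cube_checkT : cube_check.
Proof. vm_cast_no_check (erefl true). Qed.

(** * Decomposing a cycle into arcs *)

Lemma rot_flatten (T : Type) n (ss : seq (seq T)) :
  exists m, flatten (rot n ss) = rot m (flatten ss).
Proof.
exists (size (flatten (take n ss))).
have -> : flatten ss = flatten (take n ss) ++ flatten (drop n ss).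
  by rewrite -flatten_cat cat_take_drop.
by rewrite rot_size_cat -flatten_cat.
Qed.

Section Arcs.

Variables (T : eqType) (c : seq T).
Hypothesis c_uniq : uniq c.

Lemma split_two x y : y \in c -> index x c < index y c ->
  exists p1 p2 p3, c = p1 ++ x :: p2 ++ y :: p3.
Proof.
move=> yc xy; move: c_uniq xy; case/splitPr: yc => q p3 q_uniq.
have y_q : y \notin q.
  by move: q_uniq; rewrite cat_uniq => /and3P[_ /hasPn/(_ y (mem_head _ _))].
rewrite [index y _]index_cat (negPf y_q) /= eqxx addn0 => xq.
have x_q : x \in q.
  by apply: contraLR xq => x_q; rewrite index_cat (negPf x_q) -leqNgt leq_addr.
by case/splitPr: x_q => p1 p2; exists p1, p2, p3; rewrite -catA.
Qed.

Lemma split_index p1 x p2 : c = p1 ++ x :: p2 -> index x c = size p1.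
Proof.
move=> def_c; move: c_uniq; rewrite def_c cat_uniq.
case/and3P=> _ /hasPn/(_ x (mem_head _ _))/negPf x_p1 _.
by rewrite index_cat x_p1 /= eqxx addn0.
Qed.

Lemma arc_forward x y : y \in c -> index x c < index y c ->
  arc c x y = take (index y c - index x c) (drop (index x c) c).
Proof.
move=> yc xy; have [p1 [p2 [p3 def_c]]] := split_two yc xy.
have x_c : x \in c by rewrite def_c mem_cat mem_head orbT.
rewrite -(arc_rot (size p1)) // (split_index def_c).
have -> : index y c = size (p1 ++ x :: p2).
  by apply: (split_index (p2 := p3)); rewrite -catA.
have rot_c : rot (size p1) c = x :: p2 ++ y :: (p3 ++ p1).
  by rewrite def_c rot_size_cat /= -catA.
rewrite rot_c left_arc; last by rewrite -rot_c rot_uniq.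
by rewrite size_cat addKn def_c drop_size_cat // -cat_cons take_size_cat.
Qed.

Lemma arc_backward x y : x \in c -> index y c < index x c ->
  arc c x y = drop (index x c) c ++ take (index y c) c.
Proof.
move=> xc yx; have [p1 [p2 [p3 def_c]]] := split_two xc yx.
rewrite -(arc_rot (size p1)) // (split_index def_c).
have -> : index x c = size (p1 ++ y :: p2).
  by apply: (split_index (p2 := p3)); rewrite -catA.
have rot_c : rot (size p1) c = y :: p2 ++ x :: (p3 ++ p1).
  by rewrite def_c rot_size_cat /= -catA.
rewrite rot_c right_arc; last by rewrite -rot_c rot_uniq.
by rewrite def_c take_size_cat // -[y :: p2 ++ _]cat_cons catA drop_size_cat.
Qed.

Lemma map_next (A : Type) (F : T -> T -> A) x s : uniq (x :: s) ->
  [seq F y (next (x :: s) y) | y <- x :: s] = rcons (pairmap F x s) (F (last x s) x).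
Proof.
move=> s_uniq; apply: (@eq_from_nth _ (F x x)).
  by rewrite size_rcons size_pairmap size_map.
move=> i; rewrite size_map => i_s; rewrite (nth_map x) // next_nth mem_nth // index_uniq //.
rewrite nth_rcons size_pairmap; move: i_s; rewrite ltnS.
case: ltngtP => // [i_s _|-> _]; first by rewrite (nth_pairmap x).
by rewrite [nth _ s _]nth_default // -[last x s]/(last x (x :: s)) -(nth_last x).
Qed.

Lemma flatten_arcs xs : 1 < size xs -> {subset xs <= c} ->
  sorted ltn [seq index x c | x <- xs] ->
  exists m, flatten [seq arc c x (next xs x) | x <- xs] = rot m c.
Proof.
case: xs => // x xs xs_gt0 sub xs_sorted.
have xs_uniq : uniq (x :: xs).
  by apply: map_uniq (sorted_uniq ltn_trans ltnn xs_sorted).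
exists (index x c); rewrite map_next // -cats1 flatten_cat /= cats0.
have xs_cat y ys : {subset y :: ys <= c} -> sorted ltn [seq index x c | x <- y :: ys] ->
    index y c <= index (last y ys) c /\
    flatten (pairmap (arc c) y ys) =
    take (index (last y ys) c - index y c) (drop (index y c) c).
  elim: ys y => [|z ys IHys] y sub_y /=; first by rewrite subnn take0.
  case/andP=> yz /IHys[|le_z ->]; first by move=> t t_ys; rewrite sub_y // inE t_ys orbT.
  have zc : z \in c by rewrite sub_y // !inE eqxx orbT.
  split; first exact: leq_trans (ltnW yz) le_z.
  rewrite arc_forward //.
  have -> : drop (index z c) c = drop (index z c - index y c) (drop (index y c) c).
    by rewrite drop_drop subnK // ltnW.
  by rewrite -takeD addnC addnBA ?subnK // ltnW.
have [le_last ->] := xs_cat x xs sub xs_sorted.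
have lt_last : index x c < index (last x xs) c.
  rewrite ltn_neqAle le_last andbT; apply: contraTneq xs_uniq => eq_i.
  have eq_last : x = last x xs.
    by rewrite -[RHS](nth_index x (sub _ (mem_last x xs))) -eq_i nth_index // sub ?mem_head.
  by case: (xs) xs_gt0 eq_last => //= y ys _ ->; rewrite mem_last.
rewrite arc_backward ?sub ?mem_last // catA; congr (_ ++ _).
have -> : drop (index (last x xs) c) c =
    drop (index (last x xs) c - index x c) (drop (index x c) c).
  by rewrite drop_drop subnK // ltnW.
exact: cat_take_drop.
Qed.

Lemma mem_behead_arc x y t : y \in c -> index x c < index y c ->
  t \in behead (arc c x y) -> [/\ t \in c, index x c < index t c & index t c < index y c].
Proof.
move=> yc xy; have [p1 [p2 [p3 def_c]]] := split_two yc xy.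
have x_c : x \in c by rewrite def_c mem_cat mem_head orbT.
rewrite -(arc_rot (size p1)) // (split_index def_c).
have -> : index y c = size (p1 ++ x :: p2).
  by apply: (split_index (p2 := p3)); rewrite -catA.
have rot_c : rot (size p1) c = x :: p2 ++ y :: (p3 ++ p1).
  by rewrite def_c rot_size_cat /= -catA.
rewrite rot_c left_arc; last by rewrite -rot_c rot_uniq.
move=> /= /splitPr def_t; case: def_t def_c => q1 q2 def_c {rot_c}.
have -> : index t c = size (p1 ++ x :: q1).
  by apply: (split_index (p2 := q2 ++ y :: p3)); rewrite def_c -!catA /= -?catA.
split; first by rewrite def_c !(mem_cat, inE) eqxx !orbT.
- by rewrite size_cat -addn1 leq_add2l.
- by rewrite !size_cat ltn_add2l /= size_cat ltnS -addSnnS leq_addr.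
Qed.

End Arcs.

(** * Disjoint paths between two longest cycles *)

Definition longest_cycle (T : finType) (e : rel T) (c : seq T) : Prop :=
  graph_cycle e c /\ forall z, graph_cycle e z -> size z <= size c.

Record linkage (T : finType) (K : eqType) (e : rel T) (c : bool -> seq T)
    (X : {pred K}) (f : bool -> K -> T) (P : K -> seq T) : Prop := Linkage {
  linkage_mem : forall b, {in X, forall x, f b x \in c b};
  linkage_notin : forall b, {in X, forall x, f b x \notin c (~~ b)};
  linkage_path : {in X, forall x, path e (f false x) (rcons (P x) (f true x))};
  linkage_uniq : {in X, forall x, uniq (P x)};
  linkage_private : forall b, {in X, forall x t, t \in P x -> t \notin c b};
  linkage_disjoint : {in X &, forall x y t, t \in P x -> t \in P y -> x = y};
  linkage_inj : forall b, {in X &, injective (f b)}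
}.

Lemma next_map_in (T1 T2 : eqType) (h : T1 -> T2) (s : seq T1) :
  {in s &, injective h} -> {in s, forall x, next (map h s) (h x) = h (next s x)}.
Proof.
move=> h_inj x xs; rewrite !next_nth map_f // xs.
have -> : index (h x) (map h s) = index x s.
  elim: s h_inj xs => //= y s IHs h_inj; rewrite inE.
  case: (eqVneq x y) => [->|xy] /=; first by rewrite !eqxx.
  move=> xs; rewrite (inj_in_eq h_inj) ?mem_head ?inE ?xs ?orbT //.
  rewrite eq_sym (negPf xy) IHs // => a b a_s b_s.
  by apply: h_inj; rewrite inE ?a_s ?b_s orbT.
move: (index x s); case: s xs {h_inj} => // y s _ i /=.
by elim: s i => [|z s IHs] [|i] //=.
Qed.

Lemma next_neq (T : eqType) (s : seq T) x : 1 < size s -> uniq s -> x \in s -> next s x != x.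
Proof.
move=> s_gt1 s_uniq /rot_to[i s' rots].
rewrite -(next_rot i s_uniq) rots; move: s_gt1 s_uniq.
rewrite -(size_rot i) -(rot_uniq i) rots; case: s' {rots} => //= y s' _.
by rewrite eqxx inE => /andP[/norP[xy _] _]; rewrite eq_sym.
Qed.

Lemma arc_cons (T : eqType) (c : seq T) x y : x \in c -> x != y ->
  arc c x y = x :: behead (arc c x y).
Proof.
move=> xc xy; rewrite /arc (rot_index xc).
by rewrite /= (negPf xy).
Qed.

Section Linkage.

Variables (T : finType) (K : eqType) (e : rel T) (c : bool -> seq T).
Variables (X : {pred K}) (f : bool -> K -> T) (P : K -> seq T).
Hypothesis e_sym : symmetric e.
Hypothesis c_longest : forall b, longest_cycle e (c b).
Hypothesis cXfP : linkage e c X f P.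

Definition position b x := index (f b x) (c b).

Definition segment b x := count [in c (~~ b)] (take (position b x) (c b)).

Lemma position_inj b : {in X &, injective (position b)}.
Proof.
move=> x y xX yX eq_pos; apply: (linkage_inj cXfP (b := b)) => //.
have [fx fy] := (linkage_mem cXfP b xX, linkage_mem cXfP b yX).
by rewrite -(nth_index (f b x) fx) -[RHS](nth_index (f b x) fy) -/(position b x) eq_pos.
Qed.

Lemma segment_mono b x y : position b x <= position b y -> segment b x <= segment b y.
Proof.
move=> xy; rewrite /segment -(subnKC xy) takeD count_cat.
exact: leq_addr.
Qed.

Lemma position_lt_segment b x y : segment b x < segment b y -> position b x < position b y.
Proof. by apply: contraTT; rewrite -!leqNgt => /segment_mono. Qed.

Lemma linkage_exchange (s : bool -> seq nat) inner ds (g : nat -> K) :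
  exchange s inner ds ->
  (forall b, 1 < size (s b) /\ uniq (s b)) ->
  (forall b, {in s b, forall j, g j \in X} /\ {in s b &, injective g}) ->
  (forall b, exists r, sorted ltn [seq position b (g j) | j <- rot r (s b)]) ->
  (forall b j, (b, j) \in inner -> [/\ j \in s b,
      position b (g j) < position b (g (next (s b) j)) &
      segment b (g j) = segment b (g (next (s b) j))]
    \/ {in c b, forall t, t \notin c (~~ b)}) ->
  False.
Proof.
move=> exch s_ok g_ok s_sorted inner_ok.
have c_uniq b : uniq (c b) by case: (c_longest b) => -[_ /andP[]].
have c_cyc b : cycle e (c b) by case: (c_longest b) => -[_ /andP[]].
pose phi (x : bool * nat) := f x.1 (g x.2).
pose w (x : bool * nat) := behead (arc (c x.1) (phi x) (phi (x.1, next (s x.1) x.2))).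
have phi_c b j : j \in s b -> phi (b, j) \in c b.
  by case: (g_ok b) => gX _ js; apply: (linkage_mem cXfP); apply: gX.
have sub_rot b : exists m m', rot m' (subdivided_cycle s phi w b) = rot m (c b).
  have [r r_sorted] := s_sorted b; have [s_gt1 s_uniq] := s_ok b; have [gX g_inj] := g_ok b.
  have phi_inj : {in s b &, injective (fun j => phi (b, j))}.
    by move=> i j i_s j_s /(linkage_inj cXfP) eq_g; apply: g_inj => //; apply: eq_g; apply: gX.
  have [|||m] := @flatten_arcs _ (c b) (c_uniq b) [seq phi (b, j) | j <- rot r (s b)].
  - by rewrite size_map size_rot.
  - by move=> t /mapP[j]; rewrite mem_rot => js ->; apply: phi_c.
  - by rewrite -map_comp.
  move=> arcs_rot; exists m.
  have [m' sub_m'] := rot_flatten r [seq phi (b, j) :: w (b, j) | j <- s b].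
  exists m'; rewrite -sub_m' -map_rot -arcs_rot -map_comp; congr flatten.
  apply/eq_in_map => j; rewrite mem_rot => js /=.
  have nj : next (s b) j \in s b by rewrite mem_next.
  rewrite (next_map_in (h := fun j => phi (b, j))); last 2 first.
  - by move=> i k; rewrite !mem_rot; apply: phi_inj.
  - by rewrite mem_rot.
  rewrite next_rot // [RHS]arc_cons ?phi_c //.
  apply: contraNneq (next_neq s_gt1 s_uniq js) => eq_phi.
  by rewrite -(phi_inj _ _ js nj eq_phi).
have sub_mem b : subdivided_cycle s phi w b =i c b.
  by move=> t; have [m [m' eq_rot]] := sub_rot b; rewrite -(mem_rot m') eq_rot mem_rot.
have sub_size b : size (subdivided_cycle s phi w b) = size (c b).
  by have [m [m' eq_rot]] := sub_rot b; rewrite -(size_rot m') eq_rot size_rot.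
have [|||||||||z] := @exchange_longer _ s T e e_sym phi w (P \o g) inner _ _ _ _ _ _ _ _ _ ds exch.
- by move=> b; case: (s_ok b).
- by move=> b; have [m [m' eq_rot]] := sub_rot b; rewrite -(rot_uniq m') eq_rot rot_uniq.
- by move=> b; have [m [m' eq_rot]] := sub_rot b; rewrite -(rot_cycle m') eq_rot rot_cycle.
- move=> b j js; rewrite sub_mem; apply: (linkage_notin cXfP).
  by case: (g_ok b) => gX _; apply: gX.
- move=> b j t /inner_ok inn; rewrite sub_mem => t_w; case: inn => [[js lt_pos eq_seg]|excl].
    have [gX _] := g_ok b.
    have nc : f b (g (next (s b) j)) \in c b.
      by apply: (linkage_mem cXfP); apply: gX; rewrite mem_next.
    have [tc lt1 lt2] := mem_behead_arc (c_uniq b) nc lt_pos t_w.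
    apply/negP => t_other; move: eq_seg; rewrite /segment.
    rewrite -(subnKC (ltnW lt_pos)) takeD count_cat => /eqP.
    rewrite -{1}[count _ _]addn0 eqn_add2l eq_sym -leqn0 leqNgt -has_count => /negP; apply.
    have /negPf t_before : t \notin take (position b (g j)) (c b).
      by rewrite in_take // -leqNgt ltnW.
    apply/hasP; exists t => //; have := in_take (position b (g (next (s b) j))) tc.
    by rewrite -{1}(subnKC (ltnW lt_pos)) takeD mem_cat t_before /= => ->.
  by apply: excl; have := mem_take (mem_behead t_w); rewrite mem_rot.
- move=> j js; apply: (linkage_path cXfP).
  by case: (g_ok false) => gX _; apply: gX.
- move=> j js; apply: (linkage_uniq cXfP).
  by case: (g_ok false) => gX _; apply: gX.
- move=> b j t js; rewrite sub_mem; apply: (linkage_private cXfP).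
  by case: (g_ok false) => gX _; apply: gX.
- move=> i j t i_s j_s ti tj; case: (g_ok false) => gX g_inj; apply: g_inj => //.
  by apply: (linkage_disjoint cXfP) ti tj; apply: gX.
- case=> z' [z_gt2 z_cyc z'_gt2 z'_cyc]; rewrite !sub_size ltnNge => /negP; apply.
  have [_ max0] := c_longest false; have [_ max1] := c_longest true.
  have eq_size : size (c false) = size (c true).
    apply/eqP; rewrite eqn_leq; apply/andP; split.
      by apply: max1; case: (c_longest false).
    by apply: max0; case: (c_longest true).
  by apply: leq_add; [apply: max0|rewrite -eq_size; apply: max0].
Qed.

End Linkage.

Section Patterns.

Variables (T : finType) (K : eqType) (e : rel T) (c : bool -> seq T).
Variables (X : {pred K}) (f : bool -> K -> T) (P : K -> seq T).
Hypothesis e_sym : symmetric e.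
Hypothesis c_longest : forall b, longest_cycle e (c b).
Hypothesis cXfP : linkage e c X f P.

Notation pos := (position c f).
Notation seg := (segment c f).

Lemma position_total b x y : x \in X -> y \in X -> x != y ->
  (pos b y < pos b x) = ~~ (pos b x < pos b y).
Proof.
move=> xX yX; apply: contraNeq => neq_lt; apply/eqP/(position_inj cXfP (b := b)) => //.
by case: ltngtP neq_lt.
Qed.

Lemma nth_labels x0 (xs : seq K) (l : seq nat) :
  uniq xs -> {subset xs <= X} -> {subset l <= iota 0 (size xs)} ->
  {in l, forall j, nth x0 xs j \in X} /\ {in l &, injective (nth x0 xs)}.
Proof.
move=> xs_uniq xsX sub; have lt_size j : j \in l -> j < size xs.
  by move/sub; rewrite mem_iota.
split=> [j /lt_size jxs|i j /lt_size ixs /lt_size jxs]; first exact/xsX/mem_nth.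
by move/eqP; rewrite nth_uniq // => /eqP.
Qed.

Lemma pair_labels x y (l : seq nat) : x \in X -> y \in X -> x != y -> {subset l <= [:: 0; 1]} ->
  {in l, forall j, nth x [:: x; y] j \in X} /\ {in l &, injective (nth x [:: x; y])}.
Proof.
move=> xX yX xy; apply: (@nth_labels x [:: x; y]); first by rewrite /= inE xy.
by move=> z; rewrite !inE => /orP[] /eqP->.
Qed.

Lemma linked_cycles_meet x y : x \in X -> y \in X -> x != y ->
  ~ {in c false, forall t, t \notin c true}.
Proof.
move=> xX yX xy excl.
wlog lt_xy : x y xX yX xy / pos false x < pos false y.
  move=> gen; case: (boolP (pos false x < pos false y)) => [|le_yx]; first exact: gen xy.
  by apply: (gen y x); rewrite // 1?eq_sym // position_total.
apply: (linkage_exchange e_sym c_longest cXfP (g := nth x [:: x; y]) disjoint_exchange).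
- by case.
- by case; apply: pair_labels.
- case; last by exists 0; rewrite /= lt_xy.
  case: (boolP (pos true x < pos true y)) => lt; first by exists 0; rewrite /= lt.
  by exists 1; rewrite /= position_total // lt.
- move=> b j _; right=> t; case: b; last exact: excl.
  by apply: contraTN => /excl.
Qed.

Lemma no_digon x y : x \in X -> y \in X -> (forall b, seg b x = seg b y) -> x = y.
Proof.
move=> xX yX eq_seg; apply/eqP; apply/negP => /negP xy.
wlog lt_xy : x y xX yX xy eq_seg / pos false x < pos false y.
  move=> gen; case: (boolP (pos false x < pos false y)) => [|le_yx]; first exact: gen xy _.
  by apply: (gen y x); rewrite // 1?eq_sym // position_total.
apply: (linkage_exchange e_sym c_longest cXfP (g := nth x [:: x; y])
  (digon_exchange (pos true x < pos true y))).
- by case=> //=; case: ifP.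
- by case; apply: pair_labels => // i /=; case: ifP => // _; rewrite !inE orbC.
- case; last by exists 0; rewrite /= lt_xy.
  by exists 0 => /=; case: ifP => lt /=; rewrite ?lt // position_total // lt.
- move=> b j; rewrite !inE => /orP[] /eqP[-> ->]; left; split=> //=.
  + by case: ifP.
  + by case: ifP => //= lt; rewrite position_total // lt.
  + by case: ifP => //= lt; rewrite eq_seg.
Qed.

Lemma no_quad x0 x1 x2 x3 : all [in X] [:: x0; x1; x2; x3] ->
  seg false x0 = seg false x1 -> seg false x2 = seg false x3 -> seg false x0 != seg false x2 ->
  seg true x0 = seg true x2 -> seg true x1 = seg true x3 -> seg true x0 != seg true x1 ->
  pos false x0 < pos false x1 -> pos false x2 < pos false x3 ->
  pos true x0 < pos true x2 -> pos true x1 < pos true x3 -> False.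
Proof.
move=> inX sf01 sf23 sf02 st02 st13 st01 pf01 pf23 pt02 pt13.
pose g := nth x0 [:: x0; x1; x2; x3].
have xs_uniq : uniq [:: x0; x1; x2; x3].
  rewrite /= !inE !negb_or !andbT; apply/and3P; split; first apply/and3P; first split.
  - by apply: contraTneq pf01 => ->; rewrite ltnn.
  - by apply: contraNneq sf02 => ->.
  - by apply: contraNneq st01 => ->; rewrite st13.
  - apply/andP; split; first by apply: contraNneq st01 => ->; rewrite st02.
    by apply: contraTneq pt13 => ->; rewrite ltnn.
  - by apply: contraTneq pf23 => ->; rewrite ltnn.
apply: (linkage_exchange e_sym c_longest cXfP (g := g) quad_exchange).
- by case.
- case; apply: (@nth_labels x0 [:: x0; x1; x2; x3]) => //.
  + exact/allP.
  + by move=> i; rewrite /two_sided !inE => /or4P[] /eqP->.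
  + exact/allP.
- case; [case: (ltngtP (seg true x0) (seg true x1)) st01 => // lt _|
         case: (ltngtP (seg false x0) (seg false x2)) sf02 => // lt _].
  + by exists 0; rewrite /= pt02 pt13 position_lt_segment // -st02.
  + by exists 2; rewrite /= pt02 pt13 position_lt_segment // -st13.
  + by exists 0; rewrite /= pf01 pf23 position_lt_segment // -sf01.
  + by exists 2; rewrite /= pf01 pf23 position_lt_segment // -sf23.
- by move=> b j; rewrite !inE => /or4P[] /eqP[-> ->]; left.
Qed.

End Patterns.

Definition cube_adj (i j : nat) : bool := [&& i < 4, j < 4 & i != j].

(* [p i j] is the position of the path joining segments [i] and [j], and [S i] that of segment [i]. *)
Definition cube_regular (p : nat -> nat -> nat) (S : nat -> nat)
    (segs ord : seq nat) (t : bool) : Prop :=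
  [/\ forall i j i' j', cube_adj i j -> cube_adj i' j' -> S i < S i' -> p i j < p i' j',
      sorted ltn [seq S i | i <- segs],
      (if S 0 < S 1 then all (fun i => S 0 < S i) segs else all (fun i => S i < S 0) segs),
      sorted ltn [seq p 0 j | j <- ord] &
      forall i j, 0 < i -> 0 < j -> cube_adj i j ->
        (if t then p i 0 < p i j else p i j < p i 0) /\
        forall l, 0 < l -> cube_adj i l -> p 0 j < p 0 l -> p i l < p i j].

Lemma eq_cube_regular p p' S segs ord t :
  ord \in end1_orders -> (forall i j, cube_adj i j -> p i j = p' i j) ->
  cube_regular p S segs ord t -> cube_regular p' S segs ord t.
Proof.
move=> ord_end eq_p [apart S_sorted u_first ord_sorted blocks]; split=> //.
- by move=> i j i' j' ij ij'; rewrite -!eq_p //; apply: apart.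
- by move: ord_end ord_sorted; rewrite !inE => /or4P[] /eqP->; rewrite /= !eq_p.
- move=> i j i0 j0 ij; have [uij rev_ij] := blocks i j i0 j0 ij.
  have adj_i0 : cube_adj i 0 by case/and3P: ij => i4 _ _; rewrite /cube_adj i4 -lt0n.
  have adj0 k : 0 < k -> cube_adj i k -> cube_adj 0 k.
    by move=> k0 /and3P[_ k4 _]; rewrite /cube_adj k4 eq_sym -lt0n.
  rewrite -(eq_p i 0) // -(eq_p i j) //; split=> // l l0 il.
  by rewrite -(eq_p 0 j) -?(eq_p 0 l) -?(eq_p i l) ?adj0 //; apply: rev_ij.
Qed.

Lemma cube_side_sorted (label : nat -> nat -> nat) (q : nat -> nat) S segs ord t :
  segs \in end1_orders -> ord \in end1_orders ->
  cube_regular (fun i j => q (label i j)) S segs ord t ->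
  sorted ltn [seq q l | l <- rot (if S 0 < S 1 then 0 else 3) (cube_side label segs ord t)].
Proof.
move=> segs_end ord_end [apart S_sorted u_first ord_sorted blocks].
rewrite !inE in segs_end ord_end.
have lt0 i j : 0 < i -> cube_adj i j -> 0 < j -> t -> q (label i 0) < q (label i j).
  by move=> i0 ij j0 tT; have [] := blocks i j i0 j0 ij; rewrite tT.
have gt0 i j : 0 < i -> cube_adj i j -> 0 < j -> ~~ t -> q (label i j) < q (label i 0).
  by move=> i0 ij j0 tF; have [] := blocks i j i0 j0 ij; rewrite (negPf tF).
have rv i j l : 0 < i -> 0 < j -> 0 < l -> cube_adj i j -> cube_adj i l ->
    q (label 0 j) < q (label 0 l) -> q (label i l) < q (label i j).
  by move=> i0 j0 l0 ij il; have [_ ] := blocks i j i0 j0 ij; apply.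
case/or4P: segs_end => /eqP segs_eq; case/or4P: ord_end => /eqP ord_eq;
  subst segs ord; move: S_sorted u_first ord_sorted; rewrite /=;
  case/and3P=> S1 S2 _ u_first /and3P[o1 o2 _];
  have o3 := ltn_trans o1 o2;
  move: u_first; case: ifP => _ /and4P[u1 u2 u3 _];
  case: (t) lt0 gt0 => lt0 gt0 /=;
  rewrite ?andbT; repeat (apply/andP; split);
  by [| exact: apart | exact: rv | exact: lt0 | exact: gt0].
Qed.

Lemma next_sorted (q : nat -> nat) (xs : seq nat) l :
  sorted ltn [seq q i | i <- xs] -> l \in xs ->
  q l < q (next xs l) \/ l = last 0 xs /\ next xs l = head 0 xs.
Proof.
move=> xs_sorted lxs; rewrite next_nth lxs.
have: index l xs < size xs by rewrite index_mem.
case: xs xs_sorted lxs => // x xs xs_sorted lxs lt_i.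
case: (eqVneq (index l (x :: xs)) (size xs)) => [eq_i|ne_i]; [right|left].
  split; last by rewrite nth_default ?eq_i.
  by rewrite -(nth_last 0 (x :: xs)) -[_.-1]/(size xs) -eq_i nth_index.
have {ne_i} lt_i : index l (x :: xs) < size xs by rewrite ltn_neqAle ne_i.
have : q (nth 0 (x :: xs) (index l (x :: xs))) < q (nth 0 (x :: xs) (index l (x :: xs)).+1).
  rewrite -!(nth_map 0 0 q) //; last exact: ltnW.
  by apply: (sorted_ltn_nth ltn_trans) => //; rewrite unfold_in size_map //; apply: ltnW.
by rewrite nth_index // [nth _ _ _.+1](set_nth_default x).
Qed.

Section Cube.

Variables (T : finType) (K : eqType) (e : rel T) (c : bool -> seq T).
Variables (X : {pred K}) (f : bool -> K -> T) (P : K -> seq T).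
Hypothesis e_sym : symmetric e.
Hypothesis c_longest : forall b, longest_cycle e (c b).
Hypothesis cXfP : linkage e c X f P.

Notation pos := (position c f).
Notation seg := (segment c f).

Lemma no_cube (h : nat -> nat -> K) (A B : nat -> nat) segs1 ord1 segs2 ord2 t1 t2 :
  (forall i j, cube_adj i j ->
     [/\ h i j \in X, seg false (h i j) = A i & seg true (h i j) = B j]) ->
  (forall i j, i < 4 -> j < 4 -> (A i = A j -> i = j) /\ (B i = B j -> i = j)) ->
  segs1 \in [:: [:: 1; 2; 3]; [:: 2; 3; 1]] -> segs2 \in end1_orders ->
  ord1 \in end1_orders -> ord2 \in end1_orders ->
  cube_regular (fun i j => pos false (h i j)) A segs1 ord1 t1 ->
  cube_regular (fun j i => pos true (h i j)) B segs2 ord2 t2 -> False.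
Proof.
move=> h_ok AB_inj segs1P segs2P ord1P ord2P reg1 reg2.
have t_in t : t \in [:: false; true] by case: t.
have := cube_checkT; rewrite /cube_check.
move=> /allP/(_ _ segs1P)/allP/(_ _ ord1P)/allP/(_ _ segs2P)/allP/(_ _ ord2P).
move=> /allP/(_ _ (t_in t1))/allP/(_ _ (t_in t2)).
set s := cube_cyclic _ _ _ _ _ _ => /and3P[s1_ok s2_ok /hasP[F _ exch]].
have segs1P' : segs1 \in end1_orders by move: segs1P; rewrite !inE => /orP[] ->; rewrite ?orbT.
pose g l := h (l %/ 4) (l %% 4).
pose r b := if b then (if B 0 < B 1 then 0 else 3) else if A 0 < A 1 then 0 else 3.
have s_sorted b : sorted ltn [seq pos b (g j) | j <- rot (r b) (s b)].
  case: b.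
    apply: (cube_side_sorted (q := fun l => pos true (g l)) segs2P ord2P).
    apply: eq_cube_regular reg2 => // i j /and3P[i4 j4 _].
    by rewrite /g /edge_label mulnC divnMDl // modnMDl divn_small // modn_small // addn0.
  apply: (cube_side_sorted (q := fun l => pos false (g l)) segs1P' ord1P).
  apply: eq_cube_regular reg1 => // i j /and3P[i4 j4 _].
  by rewrite /g /edge_label mulnC divnMDl // modnMDl divn_small // modn_small // addn0.
have s_ok b : perm_eq (s b) cube_labels /\
    seg_of b (last 0 (rot (r b) (s b))) != seg_of b (head 0 (rot (r b) (s b))).
  have /andP[s_perm /allP ends] : cube_side_ok b (s b) by case: (b).
  by split=> //; apply: ends; rewrite /r; case: (b); case: ifP.
have s_lab b j : j \in s b -> cube_adj (j %/ 4) (j %% 4).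
  have [s_perm _] := s_ok b; rewrite (perm_mem s_perm) mem_filter mem_iota => /andP[ne /andP[_ j16]].
  by rewrite /cube_adj ne ltn_mod ltn_divLR // j16.
have seg_g b j : j \in s b -> seg b (g j) = (if b then B else A) (seg_of b j).
  by case: b => /s_lab/h_ok[].
have lt4 b j : j \in s b -> seg_of b j < 4.
  by case: b => /s_lab/and3P[].
apply: (linkage_exchange e_sym c_longest cXfP (g := g) exch).
- move=> b; have [s_perm _] := s_ok b.
  by rewrite (perm_size s_perm) (perm_uniq s_perm).
- move=> b; split=> [j /s_lab/h_ok[]//|i j i_s j_s eq_g].
  have [/and3P[i4 i4' _] /and3P[j4 j4' _]] := (s_lab _ _ i_s, s_lab _ _ j_s).
  have [_ Ai Bi] := h_ok _ _ (s_lab _ _ i_s); have [_ Aj Bj] := h_ok _ _ (s_lab _ _ j_s).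
  rewrite (divn_eq i 4) (divn_eq j 4).
  have [] := AB_inj _ _ i4 j4; rewrite -Ai -Aj -/(g i) -/(g j) eq_g => -> // _.
  by have [_] := AB_inj _ _ i4' j4'; rewrite -Bi -Bj -/(g i) -/(g j) eq_g => ->.
- by move=> b; exists (r b).
- move=> b j inn; left.
  have [js /eqP eq_seg] : j \in s b /\ seg_of b j == seg_of b (next (s b) j).
    by case/allpairsPdep: inn => b' [j' [_]]; rewrite mem_filter => /andP[? ?] [-> ->].
  have njs : next (s b) j \in s b by rewrite mem_next.
  split; rewrite ?seg_g -?eq_seg //.
  have [s_perm ends] := s_ok b.
  have s_uniq : uniq (s b) by rewrite (perm_uniq s_perm).
  have jr : j \in rot (r b) (s b) by rewrite mem_rot.
  case: (next_sorted (s_sorted b) jr); rewrite next_rot // => -[eq_j eq_n].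
  by move: ends; rewrite -eq_j -eq_n eq_seg eqxx.
Qed.

End Cube.

(** * Degree counting *)

Section Reals.
Local Open Scope ring_scope.
Variable R : realFieldType.
Implicit Types a b c t x y : R.

Lemma amgm3 a b c t : 0 <= a -> 0 <= b -> 0 <= c -> t ^+ 3 <= a * b * c -> 3 * t <= a + b + c.
Proof.
move=> a0 b0 c0 t3.
have s0 : 0 <= a + b + c by rewrite !addr_ge0.
case: (lerP t 0) => [t_le0|t_gt0]; first by lra.
rewrite -(@ler_pXn2r _ 3) ?nnegrE //; last by lra.
pose m := (a + b) / 2.
have ab : a * b <= m ^+ 2 by have := sqr_ge0 (a - b); rewrite /m; nra.
have m0 : 0 <= m by rewrite /m; lra.
have t3m : t ^+ 3 <= m ^+ 2 * c by apply: le_trans t3 _; apply: ler_wpM2r.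
have -> : a + b + c = 2 * m + c by rewrite /m; field.
have : 0 <= (m - c) ^+ 2 * (8 * m + c) by rewrite mulr_ge0 ?sqr_ge0 //; lra.
nra.
Qed.

Lemma inv_sum_ge3 a b : 0 < a -> 0 < b -> 3 <= a * b + a^-1 + b^-1.
Proof.
move=> a0 b0; rewrite -[X in X <= _]mulr1; apply: amgm3; rewrite ?mulr_ge0 ?invr_ge0 ?(ltW a0) ?(ltW b0) //.
by rewrite expr1n -mulrA -invfM mulfV // mulf_neq0 // gt_eqF.
Qed.

(* Linearization of Hölder's inequality: the tangent line of [y |-> (k y^2)^(1/3)] at the mean. *)
Lemma holder32 (I : finType) (A : {pred I}) (x y : I -> R) (k : R) :
  0 <= k -> (forall i, i \in A -> 0 <= x i) -> (forall i, i \in A -> 0 <= y i) ->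
  (forall i, i \in A -> x i ^+ 3 <= k * y i ^+ 2) ->
  (\sum_(i in A) x i) ^+ 3 <= k * #|A|%:R * (\sum_(i in A) y i) ^+ 2.
Proof.
move=> k0 x0 y0 xy; set X := \sum_(i in A) x i; set Y := \sum_(i in A) y i.
have Y0 : 0 <= Y by apply: sumr_ge0.
have X0 : 0 <= X by apply: sumr_ge0.
have N0 : 0 <= #|A|%:R :> R by apply: ler0n.
case: (eqVneq X 0) => [->|Xn0]; first by rewrite expr0n /= !mulr_ge0 ?sqr_ge0.
have Xgt : 0 < X by rewrite lt0r Xn0.
have bound i : i \in A -> 3 * (x i * X ^+ 2 * Y) <= 2 * (y i * X ^+ 3) + k * Y ^+ 3.
  move=> iA.
  have -> : 2 * (y i * X ^+ 3) + k * Y ^+ 3 = y i * X ^+ 3 + y i * X ^+ 3 + k * Y ^+ 3 by ring.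
  apply: amgm3; rewrite ?mulr_ge0 ?exprn_ge0 ?y0 //.
  have -> : y i * X ^+ 3 * (y i * X ^+ 3) * (k * Y ^+ 3) = k * y i ^+ 2 * (X ^+ 6 * Y ^+ 3) by ring.
  have -> : (x i * X ^+ 2 * Y) ^+ 3 = x i ^+ 3 * (X ^+ 6 * Y ^+ 3) by ring.
  by apply: ler_wpM2r; rewrite ?mulr_ge0 ?exprn_ge0 ?xy.
have Ypos : 0 < Y.
  rewrite lt0r Y0 andbT; apply: contra_neq Xn0 => Y_0.
  apply: big1 => i iA; have yi0 : y i = 0.
    by apply/eqP; move/eqP: Y_0; rewrite psumr_eq0 // => /allP/(_ i); rewrite mem_index_enum iA => /(_ isT).
  have := xy i iA; rewrite yi0 expr0n mulr0 => xi3.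
  have : x i ^+ 3 == 0 by rewrite eq_le xi3 exprn_ge0 ?x0.
  by rewrite expf_eq0 /= => /eqP.
have : \sum_(i in A) 3 * (x i * X ^+ 2 * Y) <= \sum_(i in A) (2 * (y i * X ^+ 3) + k * Y ^+ 3).
  exact: ler_sum.
rewrite big_split /= -!mulr_sumr -!mulr_suml sumr_const -/X -/Y => sum_le.
have : X ^+ 3 * Y <= k * #|A|%:R * Y ^+ 2 * Y.
  move: sum_le; rewrite -[_ *+ #|A|]mulr_natr; set n := #|A|%:R; nra.
by rewrite ler_pM2r.
Qed.

Lemma fifth_power_bound (e n x c d B : R) : 0 <= e -> 0 <= n -> 0 <= x -> 0 <= c ->
  e ^+ 3 <= n * n * (c * (n * e) + x) -> e <= n * n -> x ^+ 3 <= d * n ^+ 2 * e ^+ 4 ->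
  (2 * c) ^+ 2 <= B -> 2 ^+ 3 * d <= B -> e ^+ 5 <= B * n ^+ 8.
Proof.
move=> e0 n0 x0 c0 e3_le e_le x3_le cB dB.
have B0 : 0 <= B by apply: le_trans cB; rewrite sqr_ge0.
have [->|e_neq0] := eqVneq e 0; first by rewrite expr0n /= mulr_ge0 ?exprn_ge0.
have e_gt0 : 0 < e by rewrite lt0r e_neq0.
have [x_small|x_large] := lerP x (c * (n * e)).
  have e2 : e ^+ 2 <= 2 * c * n ^+ 3.
    rewrite -(ler_pM2r e_gt0); apply: le_trans (_ : e ^+ 3 <= _); first by rewrite -exprSr.
    apply: le_trans e3_le _.
    have -> : 2 * c * n ^+ 3 * e = n * n * (c * (n * e) + c * (n * e)) by ring.
    by rewrite ler_wpM2l ?mulr_ge0 // lerD2l.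
  have -> : e ^+ 5 = e ^+ 2 * e ^+ 2 * e by ring.
  apply: le_trans (_ : (2 * c * n ^+ 3) * (2 * c * n ^+ 3) * (n * n) <= _).
    by apply: ler_pM; rewrite ?mulr_ge0 ?exprn_ge0 //; apply: ler_pM; rewrite ?exprn_ge0.
  have -> : 2 * c * n ^+ 3 * (2 * c * n ^+ 3) * (n * n) = (2 * c) ^+ 2 * n ^+ 8 by ring.
  by rewrite ler_wpM2r ?exprn_ge0.
have e3 : e ^+ 3 <= 2 * (n ^+ 2 * x).
  apply: le_trans e3_le _; have -> : 2 * (n ^+ 2 * x) = n * n * (x + x) by ring.
  by rewrite ler_wpM2l ?mulr_ge0 // lerD2r ltW.
have e9 : (e ^+ 3) ^+ 3 <= (2 * (n ^+ 2 * x)) ^+ 3.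
  by rewrite lerXn2r ?nnegrE ?mulr_ge0 ?exprn_ge0.
rewrite -(ler_pM2r (exprn_gt0 4 e_gt0)).
have -> : e ^+ 5 * e ^+ 4 = (e ^+ 3) ^+ 3 by ring.
apply: le_trans e9 _.
have -> : (2 * (n ^+ 2 * x)) ^+ 3 = 2 ^+ 3 * n ^+ 6 * x ^+ 3 by ring.
apply: le_trans (ler_wpM2l _ x3_le) _; first by rewrite mulr_ge0 ?exprn_ge0.
have -> : 2 ^+ 3 * n ^+ 6 * (d * n ^+ 2 * e ^+ 4) = 2 ^+ 3 * d * (n ^+ 8 * e ^+ 4) by ring.
by rewrite -[leRHS]mulrA ler_wpM2r ?mulr_ge0 ?exprn_ge0.
Qed.

End Reals.

Section Degrees.

Variables (V1 V2 : finType) (M : {set V1 * V2}) (A : {set V1}) (B : {set V2}).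
Hypothesis sub_M : M \subset setX A B.

Definition deg1 a := #|[set x in M | x.1 == a]|.
Definition deg2 b := #|[set x in M | x.2 == b]|.

Lemma deg1_gt0 x : x \in M -> 0 < deg1 x.1.
Proof. by move=> xM; apply/card_gt0P; exists x; rewrite inE xM eqxx. Qed.

Lemma deg2_gt0 x : x \in M -> 0 < deg2 x.2.
Proof. by move=> xM; apply/card_gt0P; exists x; rewrite inE xM eqxx. Qed.

Local Open Scope ring_scope.

Lemma sum_inv_deg1 : \sum_(x in M) (deg1 x.1)%:R^-1 <= #|A|%:R :> rat.
Proof.
rewrite (partition_big (fun x : V1 * V2 => x.1) [in A]) /=; last first.
  by move=> [a b] /(subsetP sub_M); rewrite inE => /andP[].
rewrite -sumr_const; apply: ler_sum => a aA.
rewrite (eq_bigr (fun=> (deg1 a)%:R^-1)); last by move=> x /andP[_ /eqP->].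
rewrite sumr_const.
have -> : #|[pred x | (x \in M) && (x.1 == a)]| = deg1 a by apply: eq_card => x; rewrite !inE.
case: (deg1 a) => [|d]; first by rewrite mulr0n.
by rewrite -(mulr_natr d.+1%:R^-1) mulVf // pnatr_eq0.
Qed.

Lemma sum_inv_deg2 : \sum_(x in M) (deg2 x.2)%:R^-1 <= #|B|%:R :> rat.
Proof.
rewrite (partition_big (fun x : V1 * V2 => x.2) [in B]) /=; last first.
  by move=> [a b] /(subsetP sub_M); rewrite inE => /andP[].
rewrite -sumr_const; apply: ler_sum => b bB.
rewrite (eq_bigr (fun=> (deg2 b)%:R^-1)); last by move=> x /andP[_ /eqP->].
rewrite sumr_const.
have -> : #|[pred x | (x \in M) && (x.2 == b)]| = deg2 b by apply: eq_card => x; rewrite !inE.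
case: (deg2 b) => [|d]; first by rewrite mulr0n.
by rewrite -(mulr_natr d.+1%:R^-1) mulVf // pnatr_eq0.
Qed.

Let h : rat := #|M|%:R.
Let p : rat := #|A|%:R.
Let q : rat := #|B|%:R.

Lemma subset_sides : (0 < #|M| -> 0 < #|A| /\ 0 < #|B|)%N.
Proof.
case/card_gt0P=> -[a b] /(subsetP sub_M); rewrite inE => /andP[aA bB].
by split; apply/card_gt0P; [exists a|exists b].
Qed.

(* The sum over the edges of the inverse degrees of their ends counts each vertex at most once. *)
Lemma edge_weight_sum (w : V1 * V2 -> rat) (c1 c2 : rat) : 0 <= c1 -> 0 <= c2 ->
  (forall x, x \in M -> 3 <= w x + c1 * (deg1 x.1)%:R^-1 + c2 * (deg2 x.2)%:R^-1) ->
  3 * h <= \sum_(x in M) w x + c1 * p + c2 * q.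
Proof.
move=> c1_ge0 c2_ge0 w_ge.
have -> : 3 * h = \sum_(x in M) 3 by rewrite sumr_const -(mulr_natr 3).
apply: le_trans (ler_sum _ w_ge) _.
rewrite !big_split /= -!mulr_sumr.
apply: lerD; first apply: lerD => //.
  by apply: ler_wpM2l => //; apply: sum_inv_deg1.
by apply: ler_wpM2l => //; apply: sum_inv_deg2.
Qed.

Lemma cube_card_le_degree_product :
  (#|M| ^ 3 <= #|A| * #|B| * \sum_(x in M) deg1 x.1 * deg2 x.2)%N.
Proof.
have [-> //|M_gt0] := posnP #|M|.
have [A_gt0 B_gt0] := subset_sides M_gt0.
rewrite -(@ler_nat rat) natrX !natrM natr_sum -/h -/p -/q.
have [h0 p0 q0] : [/\ 0 < h, 0 < p & 0 < q] by rewrite !ltr0n.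
pose w (x : V1 * V2) : rat := (deg1 x.1 * deg2 x.2)%:R * (p * q / h ^+ 2).
have : 3 * h <= \sum_(x in M) w x + (h / p) * p + (h / q) * q.
  apply: edge_weight_sum; [by rewrite divr_ge0 ?ltW|by rewrite divr_ge0 ?ltW|move=> x xM].
  have d1 : 0 < (deg1 x.1)%:R :> rat by rewrite ltr0n deg1_gt0.
  have d2 : 0 < (deg2 x.2)%:R :> rat by rewrite ltr0n deg2_gt0.
  have := inv_sum_ge3 (divr_gt0 (mulr_gt0 d1 p0) h0) (divr_gt0 (mulr_gt0 d2 q0) h0).
  move/le_trans; apply; rewrite le_eqVlt; apply/orP; left; apply/eqP.
  by rewrite /w natrM; field; rewrite !gt_eqF.
rewrite !divfK ?gt_eqF // /w -mulr_suml => le_w.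
have {}le_w : h <= (\sum_(x in M) (deg1 x.1 * deg2 x.2)%:R) * (p * q / h ^+ 2) by lra.
rewrite mulrA ler_pdivlMr ?exprn_gt0 // in le_w.
by rewrite exprS mulrC [p * q * _]mulrC mulrC.
Qed.

Lemma cube_card_le_path_count : (6 * (#|A| + #|B|) <= #|M|)%N ->
  (#|M| ^ 3 <= 8 * (#|A| * #|B|) * \sum_(x in M) (deg1 x.1).-1 * (deg2 x.2).-1)%N.
Proof.
have [-> //|M_gt0] := posnP #|M|.
have [A_gt0 B_gt0] := subset_sides M_gt0.
rewrite -!(@ler_nat rat) natrX !natrM natrD natr_sum -/h -/p -/q.
have [h0 p0 q0] : [/\ 0 < h, 0 < p & 0 < q] by rewrite !ltr0n.
move=> h_large.
pose w (x : V1 * V2) : rat := ((deg1 x.1).-1 * (deg2 x.2).-1)%:R * (4 * (p * q / h ^+ 2)).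
have : 3 * h <= \sum_(x in M) w x + (h / p + 3) * p + (h / q + 3) * q.
  have c_ge0 d : 0 < d -> 0 <= h / d + 3 by move=> d0; rewrite addr_ge0 // divr_ge0 ?ltW.
  apply: edge_weight_sum; [exact: c_ge0|exact: c_ge0|move=> x xM].
  have := deg1_gt0 xM; have := deg2_gt0 xM.
  rewrite /w; case: (deg1 x.1) (deg2 x.2) => [|d1] [|d2] //= _ _.
  have w0 : 0 <= (d1 * d2)%:R * (4 * (p * q / h ^+ 2)).
    by rewrite !mulr_ge0 ?ler0n ?invr_ge0 ?exprn_ge0 ?ltW.
  have s1 : 0 <= (h / p + 3) * d1.+1%:R^-1.
    by rewrite mulr_ge0 ?invr_ge0 ?ler0n ?addr_ge0 ?divr_ge0 ?ltW.
  have s2 : 0 <= (h / q + 3) * d2.+1%:R^-1.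
    by rewrite mulr_ge0 ?invr_ge0 ?ler0n ?addr_ge0 ?divr_ge0 ?ltW.
  have ge3 a b b' c : 0 <= a -> 0 <= b -> 0 <= b' ->
    c = b + 3 -> 3 <= a + c + b' /\ 3 <= a + b' + c :> rat.
    by move=> *; lra.
  case: d1 w0 s1 => [|d1] w0 s1.
    have hp : 0 <= h / p by rewrite divr_ge0 ?ltW.
    by rewrite invr1 mulr1; have [] := ge3 _ _ _ _ w0 hp s2 erefl.
  case: d2 w0 s2 => [|d2] w0 s2.
    have hq : 0 <= h / q by rewrite divr_ge0 ?ltW.
    by rewrite invr1 mulr1; have [] := ge3 _ _ _ _ w0 hq s1 erefl.
  have e1 : 0 < d1.+2%:R :> rat by rewrite ltr0n.
  have e2 : 0 < d2.+2%:R :> rat by rewrite ltr0n.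
  have := inv_sum_ge3 (divr_gt0 (mulr_gt0 e1 p0) h0) (divr_gt0 (mulr_gt0 e2 q0) h0).
  move/le_trans; apply; rewrite -!addrA lerD //; last first.
    have le_term (d r : rat) : 0 < d -> 0 < r -> (d * r / h)^-1 <= (h / r + 3) / d.
      move=> d0 r0; have -> : (d * r / h)^-1 = h / r / d by field; rewrite !gt_eqF.
      by rewrite ler_wpM2r ?invr_ge0 ?(ltW d0) // lerDl.
    by apply: lerD; apply: le_term.
  have -> : d1.+2%:R * p / h * (d2.+2%:R * q / h) = (d1.+2%:R * d2.+2%:R) * (p * q / h ^+ 2).
    by field; rewrite gt_eqF.
  rewrite [_ * (4 * _)]mulrA; apply: ler_wpM2r.
    by rewrite divr_ge0 ?mulr_ge0 ?exprn_ge0 ?ltW.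
  by rewrite -!natrM ler_nat; lia.
rewrite !mulrDl !divfK ?gt_eqF // /w -mulr_suml => le_w.
have {}le_w : h <= (\sum_(x in M) ((deg1 x.1).-1 * (deg2 x.2).-1)%:R) * (8 * (p * q / h ^+ 2)) by lra.
rewrite !mulrA ler_pdivlMr ?exprn_gt0 // in le_w.
by rewrite exprS; apply: le_trans le_w _; rewrite le_eqVlt; apply/orP; left; apply/eqP; ring.
Qed.

End Degrees.

(** * The ordered Turan problem *)

Lemma end1_order_exists (F : nat -> nat) :
  F 1 != F 2 -> F 1 != F 3 -> F 2 != F 3 -> (F 3 < F 1) = (F 2 < F 1) ->
  exists2 ord, ord \in end1_orders & sorted ltn [seq F j | j <- ord].
Proof.
move=> n12 n13 n23.
case: (ltngtP (F 1) (F 2)) n12 => // lt12 _; case: (ltngtP (F 1) (F 3)) n13 => // lt13 _;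
case: (ltngtP (F 2) (F 3)) n23 => // lt23 _ _.
- by exists [:: 1; 2; 3]; rewrite ?inE //= lt12 lt23.
- by exists [:: 1; 3; 2]; rewrite ?inE //= lt13 lt23.
- by exists [:: 2; 3; 1]; rewrite ?inE //= lt13 lt23.
- by exists [:: 3; 2; 1]; rewrite ?inE //= lt12 lt23.
Qed.

Lemma sum_nat_const_type (I : finType) (n : nat) : \sum_(i : I) n = #|I| * n.
Proof. by rewrite -sum_nat_const; apply: eq_bigl. Qed.

Section Forbidden.

Variables (N : nat) (E : rel 'I_N) (p q : 'I_N -> 'I_N -> nat).
Hypothesis p_apart : forall a b a' b' : 'I_N, E a b -> E a' b' -> a < a' -> p a b < p a' b'.
Hypothesis q_apart : forall a b a' b' : 'I_N, E a b -> E a' b' -> b < b' -> q a b < q a' b'.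
Hypothesis p_inj : forall a b b', E a b -> E a b' -> p a b = p a b' -> b = b'.
Hypothesis q_inj : forall a a' b, E a b -> E a' b -> q a b = q a' b -> a = a'.
Hypothesis no_quad : forall a a' b b', a != a' -> b != b' ->
  E a b -> E a b' -> E a' b -> E a' b' ->
  p a b < p a b' -> p a' b < p a' b' -> q a b < q a' b -> q a b' < q a' b' -> False.
Hypothesis no_cube : forall (a b : nat -> 'I_N) segs1 ord1 segs2 ord2 t1 t2,
  (forall i j, cube_adj i j -> E (a i) (b j)) ->
  (forall i j, i < 4 -> j < 4 -> (a i = a j -> i = j) /\ (b i = b j -> i = j)) ->
  segs1 \in [:: [:: 1; 2; 3]; [:: 2; 3; 1]] -> segs2 \in end1_orders ->
  ord1 \in end1_orders -> ord2 \in end1_orders ->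
  cube_regular (fun i j => p (a i) (b j)) (fun i => val (a i)) segs1 ord1 t1 ->
  cube_regular (fun j i => q (a i) (b j)) (fun j => val (b j)) segs2 ord2 t2 -> False.

Section Color.

Variables u v : 'I_N.

Definition color (x : 'I_N * 'I_N) : (bool * bool) * (bool * bool) :=
  ((p x.1 v < p x.1 x.2, q u x.2 < q x.1 x.2), (u < x.1, v < x.2)).

Definition colored k : {set 'I_N * 'I_N} :=
  [set x | [&& E x.1 x.2, E u x.2, E x.1 v, x.1 != u, x.2 != v & color x == k]].

Implicit Type k : (bool * bool) * (bool * bool).

Lemma coloredP k a b : (a, b) \in colored k ->
  [/\ E a b, E u b & E a v] /\ [/\ a != u, b != v & color (a, b) = k].
Proof. by rewrite inE => /and5P[-> -> -> -> /andP[-> /eqP]]. Qed.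

Lemma colored_reverse1 k a b b' : (a, b) \in colored k -> (a, b') \in colored k ->
  p u b < p u b' -> p a b' < p a b.
Proof.
move=> /coloredP[[ab ub av] [au bv <-]] /coloredP[[ab' ub' _] [_ b'v eq_col]] lt_u.
have eq_q : (q u b' < q a b') = (q u b < q a b) := congr1 (fun k => k.1.2) eq_col.
have bb' : b != b' by apply: contraTneq lt_u => ->; rewrite ltnn.
rewrite ltnNge leq_eqVlt; apply/negP => /predU1P[/(p_inj ab ab')/eqP|lt_a].
  by rewrite (negPf bb').
have neq_q c : E a c -> E u c -> q u c <> q a c.
  by move=> ac uc /(q_inj uc ac)/eqP; rewrite eq_sym (negPf au).
case: (boolP (q u b < q a b)) eq_q => [lt_q lt_q'|].
  by apply: (no_quad (a := u) (a' := a) (b := b) (b' := b')); rewrite // eq_sym.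
rewrite -leqNgt leq_eqVlt => /predU1P[eq|lt_q /negbT]; first by case: (neq_q b ab ub).
rewrite -leqNgt leq_eqVlt => /predU1P[eq|lt_q']; first by case: (neq_q b' ab' ub').
by apply: (no_quad (a := a) (a' := u) (b := b) (b' := b')).
Qed.

Lemma colored_reverse2 k a a' b : (a, b) \in colored k -> (a', b) \in colored k ->
  q a v < q a' v -> q a' b < q a b.
Proof.
move=> /coloredP[[ab ub av] [au bv <-]] /coloredP[[a'b _ a'v] [a'u _ eq_col]] lt_v.
have eq_p : (p a' v < p a' b) = (p a v < p a b) := congr1 (fun k => k.1.1) eq_col.
have aa' : a != a' by apply: contraTneq lt_v => ->; rewrite ltnn.
rewrite ltnNge leq_eqVlt; apply/negP => /predU1P[/(q_inj ab a'b)/eqP|lt_b].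
  by rewrite (negPf aa').
have neq_p c : E c b -> E c v -> p c v <> p c b.
  by move=> cb cv /(p_inj cv cb)/eqP; rewrite eq_sym (negPf bv).
case: (boolP (p a v < p a b)) eq_p => [lt_p lt_p'|].
  by apply: (no_quad (a := a) (a' := a') (b := v) (b' := b)); rewrite // eq_sym.
rewrite -leqNgt leq_eqVlt => /predU1P[eq|lt_p /negbT]; first by case: (neq_p a ab av).
rewrite -leqNgt leq_eqVlt => /predU1P[eq|lt_p']; first by case: (neq_p a' a'b a'v).
by apply: (no_quad (a := a) (a' := a') (b := b) (b' := v)).
Qed.

Lemma colored_C4_free k a a' b b' : a != a' -> b != b' ->
  (a, b) \in colored k -> (a, b') \in colored k ->
  (a', b) \in colored k -> (a', b') \in colored k -> False.
Proof.
move=> aa' bb' ab ab' a'b a'b'.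
wlog lt_b : b b' bb' ab ab' a'b a'b' / p u b < p u b'.
  move=> gen; have [_ ub _] := (coloredP ab).1; have [_ ub' _] := (coloredP ab').1.
  case: (ltngtP (p u b) (p u b')) => [||/(p_inj ub ub')/eqP]; last by rewrite (negPf bb').
    exact: gen.
  by apply: gen; rewrite // eq_sym.
wlog lt_a : a a' aa' ab ab' a'b a'b' / q a v < q a' v.
  move=> gen; have [_ _ av] := (coloredP ab).1; have [_ _ a'v] := (coloredP a'b).1.
  case: (ltngtP (q a v) (q a' v)) => [||/(q_inj av a'v)/eqP]; last by rewrite (negPf aa').
    exact: gen.
  by apply: gen; rewrite // eq_sym.
have [[Eab _ _] _] := coloredP ab; have [[Eab' _ _] _] := coloredP ab'.
have [[Ea'b _ _] _] := coloredP a'b; have [[Ea'b' _ _] _] := coloredP a'b'.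
apply: (no_quad (a := a') (a' := a) (b := b') (b' := b)) => //; try by rewrite eq_sym.
- exact: colored_reverse1 a'b a'b' lt_b.
- exact: colored_reverse1 ab ab' lt_b.
- exact: colored_reverse2 ab' a'b' lt_a.
- exact: colored_reverse2 ab a'b lt_a.
Qed.

Lemma colored_hexagon_free k a1 a2 a3 b1 b2 b3 :
  uniq [:: a1; a2; a3] -> uniq [:: b1; b2; b3] ->
  all [in colored k] [:: (a1, b2); (a1, b3); (a2, b1); (a2, b3); (a3, b1); (a3, b2)] ->
  (a3 < a1) = (a2 < a1) -> (b3 < b1) = (b2 < b1) ->
  (p u b3 < p u b1) = (p u b2 < p u b1) -> (q a3 v < q a1 v) = (q a2 v < q a1 v) -> False.
Proof.
move=> a_uniq b_uniq all_col sideA sideB sidep sideq.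
wlog lt23 : a2 a3 b2 b3 a_uniq b_uniq all_col sideA sideB sidep sideq / a2 < a3.
  move=> gen; case: (ltngtP a2 a3) => [lt23|lt32|/val_inj eq23].
  - exact: (gen a2 a3 b2 b3).
  - apply: (gen a3 a2 b3 b2) => //.
    + by rewrite -(rev_uniq [:: _; _; _]) (perm_uniq (_ : perm_eq _ [:: a1; a2; a3])) //; apply/permP => P /=; lia.
    + by rewrite -(rev_uniq [:: _; _; _]) (perm_uniq (_ : perm_eq _ [:: b1; b2; b3])) //; apply/permP => P /=; lia.
    + by move: all_col; rewrite /= !andbT => /and5P[-> -> -> -> /andP[-> ->]].
  - by move: a_uniq; rewrite /= !inE eq23 eqxx /= andbF.
pose a := nth u [:: u; a1; a2; a3]; pose b := nth v [:: v; b1; b2; b3].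
have [c12 c13 c21 [c23 c31 c32]] : [/\ (a1, b2) \in colored k, (a1, b3) \in colored k,
    (a2, b1) \in colored k & [/\ (a2, b3) \in colored k, (a3, b1) \in colored k &
    (a3, b2) \in colored k]].
  by move: all_col => /and5P[-> -> -> -> /and3P[-> -> _]].
have [[_ ub2 a1v] [a1u b2v _]] := coloredP c12; have [[_ ub3 _] [_ b3v _]] := coloredP c13.
have [[_ ub1 a2v] [a2u b1v _]] := coloredP c21; have [[_ _ a3v] [a3u _ _]] := coloredP c31.
have col_ab i j : 0 < i -> 0 < j -> cube_adj i j -> (a i, b j) \in colored k.
  by case: i => [|[|[|[|i]]]] //; case: j => [|[|[|[|j]]]].
have Eab i j : cube_adj i j -> E (a i) (b j).
  case: (posnP i) => [->|i0]; first by case: j => [|[|[|[|j]]]].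
  case: (posnP j) => [->|j0]; first by case: i i0 => [|[|[|[|i]]]].
  by move=> adj; have [[]] := coloredP (col_ab i j i0 j0 adj).
have ab_inj i j : i < 4 -> j < 4 -> (a i = a j -> i = j) /\ (b i = b j -> i = j).
  have a_uniq4 : uniq [:: u; a1; a2; a3].
    by rewrite cons_uniq a_uniq !inE !negb_or ![u == _]eq_sym a1u a2u a3u.
  have b_uniq4 : uniq [:: v; b1; b2; b3].
    by rewrite cons_uniq b_uniq !inE !negb_or ![v == _]eq_sym b1v b2v b3v.
  by move=> i4 j4; split=> /eqP; rewrite nth_uniq // => /eqP.
have adj12 : cube_adj 1 2 by []. have adj13 : cube_adj 1 3 by [].
have adj21 : cube_adj 2 1 by []. have adj31 : cube_adj 3 1 by [].
have p_neq i j l : cube_adj i j -> cube_adj i l -> j != l -> p (a i) (b j) != p (a i) (b l).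
  move=> ij il; apply: contraNneq => /(p_inj (Eab _ _ ij) (Eab _ _ il)) eq_b.
  by case/and3P: ij il => i4 j4 _ /and3P[_ l4 _]; apply/eqP/(ab_inj j l j4 l4).2.
have q_neq i j l : cube_adj i l -> cube_adj j l -> i != j -> q (a i) (b l) != q (a j) (b l).
  move=> ij il; apply: contraNneq => /(q_inj (Eab _ _ ij) (Eab _ _ il)) eq_a.
  by case/and3P: ij il => i4 l4 _ /and3P[j4 _ _]; apply/eqP/(ab_inj i j i4 j4).1.
have a_neq i j : i < 4 -> j < 4 -> i != j -> val (a i) != val (a j).
  by move=> i4 j4; apply: contraNneq => /val_inj eq_a; apply/eqP/(ab_inj i j i4 j4).1.
have b_neq i j : i < 4 -> j < 4 -> i != j -> val (b i) != val (b j).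
  by move=> i4 j4; apply: contraNneq => /val_inj eq_b; apply/eqP/(ab_inj i j i4 j4).2.
have [ord1 ord1P ord1_sorted] : exists2 ord, ord \in end1_orders &
    sorted ltn [seq p (a 0) (b j) | j <- ord].
  by apply: end1_order_exists; rewrite ?p_neq.
have [ord2 ord2P ord2_sorted] : exists2 ord, ord \in end1_orders &
    sorted ltn [seq q (a i) (b 0) | i <- ord].
  by apply: end1_order_exists; rewrite ?q_neq.
have [segs2 segs2P segs2_sorted] : exists2 segs, segs \in end1_orders &
    sorted ltn [seq val (b j) | j <- segs].
  by apply: end1_order_exists; rewrite ?b_neq.
have [segs1 segs1P segs1_sorted] : exists2 segs,
    segs \in [:: [:: 1; 2; 3]; [:: 2; 3; 1]] & sorted ltn [seq val (a i) | i <- segs].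
  case: (ltngtP a1 a2) sideA (a_neq 1 2 isT isT isT) => // lt12 sideA _.
    by exists [:: 1; 2; 3]; rewrite ?inE //= lt12 lt23.
  by exists [:: 2; 3; 1]; rewrite ?inE //= lt23 sideA.
have segs_mem (segs : seq nat) i : segs \in end1_orders -> i \in segs -> 0 < i < 4.
  by rewrite !inE => /or4P[] /eqP->; rewrite !inE => /or3P[] /eqP->.
have segs1P' : segs1 \in end1_orders.
  by move: segs1P; rewrite !inE => /orP[] ->; rewrite ?orbT.
case def_k: k => [[t1 t2] [ku kv]].
have col_eq i j : 0 < i -> 0 < j -> cube_adj i j ->
    [/\ (p (a i) v < p (a i) (b j)) = t1, (q u (b j) < q (a i) (b j)) = t2,
        (u < a i) = ku & (v < b j) = kv].
  move=> i0 j0 ij; have [_ [_ _]] := coloredP (col_ab i j i0 j0 ij).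
  by rewrite def_k => -[].
apply: (no_cube Eab ab_inj segs1P segs2P ord1P ord2P (t1 := t1) (t2 := t2)); split=> //.
- by move=> i j i' j' /Eab ab /Eab ab'; apply: p_apart.
- have ua i : 0 < i < 4 -> (u < a i) = ku.
    case: i => [|[|[|[|i]]]] // _; first by case: (col_eq 1 2).
      by case: (col_eq 2 1).
    by case: (col_eq 3 1).
  rewrite ua //; case: ku ua {col_eq def_k} => ua; apply/allP => i /(segs_mem _ _ segs1P') i_ok.
    by rewrite ua.
  rewrite ltn_neqAle a_neq ?(andP i_ok).2 //=; last by case: i i_ok.
  by rewrite leqNgt ua.
- move=> i j i0 j0 ij; have [lt_t _ _ _] := col_eq i j i0 j0 ij.
  have ij0 : cube_adj i 0 by case/and3P: ij => i4 _ _; rewrite /cube_adj i4 -lt0n.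
  split=> [|l l0 il]; last by apply: colored_reverse1; apply: col_ab.
  case: t1 lt_t {col_eq def_k} => // /negbT; rewrite -leqNgt leq_eqVlt.
  by rewrite (negPf (p_neq i j 0 ij ij0 _)) // -lt0n.
- by move=> i j i' j' /= ij i'j'; apply: q_apart; apply: Eab; rewrite /cube_adj andbCA eq_sym.
- have vb i : 0 < i < 4 -> (v < b i) = kv.
    case: i => [|[|[|[|i]]]] // _; first by case: (col_eq 2 1).
      by case: (col_eq 1 2).
    by case: (col_eq 1 3).
  rewrite vb //; case: kv vb {col_eq def_k} => vb; apply/allP => i /(segs_mem _ _ segs2P) i_ok.
    by rewrite vb.
  rewrite ltn_neqAle b_neq ?(andP i_ok).2 //=; last by case: i i_ok.
  by rewrite leqNgt vb.
- move=> j i j0 i0 ji; have ij : cube_adj i j by rewrite /cube_adj andbCA eq_sym.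
  have [_ lt_t _ _] := col_eq i j i0 j0 ij.
  have ij0 : cube_adj 0 j by case/and3P: ji => j4 _ _; rewrite /cube_adj j4 eq_sym -lt0n.
  split=> [|l l0 jl]; last first.
    by apply: colored_reverse2; apply: col_ab; rewrite // /cube_adj andbCA eq_sym.
  case: t2 lt_t {col_eq def_k} => // /negbT; rewrite -leqNgt leq_eqVlt.
  by rewrite (negPf (q_neq i 0 j ij ij0 _)) // -lt0n.
Qed.


Definition sideA : {set 'I_N} := [set a | E a v].
Definition sideB : {set 'I_N} := [set b | E u b].

Lemma colored_sub k : colored k \subset setX sideA sideB.
Proof. by apply/subsetP=> -[a b] /coloredP[[_ ub av] _]; rewrite !inE ub av. Qed.

Lemma few_colored_paths k a b :
  #|[set x in colored k | [&& (x.1, b) \in colored k, b != x.2,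
       (a, x.2) \in colored k & a != x.1]]| <= 16.
Proof.
pose bits (x : 'I_N * 'I_N) :=
  ((x.1 < a, x.2 < b), (p u x.2 < p u b, q x.1 v < q a v)).
set Q := [set _ | _].
have QP x : x \in Q ->
    [/\ x \in colored k, (x.1, b) \in colored k, b != x.2, (a, x.2) \in colored k & a != x.1].
  by rewrite inE => /and5P.
have bits_inj : {in Q &, injective bits}.
  move=> [a2 b3] [a3 b2] /QP[/= x_col a2b bb3 ab3 aa2] /QP[/= x'_col a3b bb2 ab2 aa3] eq_bits.
  have sideA_eq : (a2 < a) = (a3 < a) := congr1 (fun k => k.1.1) eq_bits.
  have sideB_eq : (b3 < b) = (b2 < b) := congr1 (fun k => k.1.2) eq_bits.
  have sidep_eq : (p u b3 < p u b) = (p u b2 < p u b) := congr1 (fun k => k.2.1) eq_bits.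
  have sideq_eq : (q a2 v < q a v) = (q a3 v < q a v) := congr1 (fun k => k.2.2) eq_bits.
  case: (eqVneq a2 a3) x_col x'_col => [<-|a23] x_col x'_col.
    case: (eqVneq b3 b2) x'_col => [<-//|b32] x'_col.
    by case: (colored_C4_free aa2 b32 ab3 ab2 x_col x'_col).
  case: (eqVneq b3 b2) x'_col => [eq_b|b32] x'_col.
    rewrite -eq_b in x'_col; rewrite eq_sym in bb3.
    by case: (colored_C4_free a23 bb3 x_col a2b x'_col a3b).
  case: (@colored_hexagon_free k a a2 a3 b b2 b3) => //.
  - by rewrite /= !inE negb_or aa2 aa3 a23.
  - by rewrite /= !inE negb_or bb2 bb3 eq_sym b32.
  - by rewrite /= ab2 ab3 a2b x_col a3b x'_col.
have <- : #|{: (bool * bool) * (bool * bool)}| = 16 by rewrite !card_prod card_bool.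
by rewrite -(card_in_imset bits_inj) max_card.
Qed.

Lemma colored_path_count k :
  \sum_(x in colored k) (deg1 (colored k) x.1).-1 * (deg2 (colored k) x.2).-1
    <= 16 * (#|sideA| * #|sideB|).
Proof.
set M := colored k.
have le_deg1 (x : 'I_N * 'I_N) : x \in M ->
    (deg1 M x.1).-1 <= \sum_(b in sideB) (((x.1, b) \in M) && (b != x.2)).
  move=> xM; have xD : x \in [set y in M | y.1 == x.1] by rewrite inE xM eqxx.
  rewrite /deg1 (cardsD1 x) xD /= -big_mkcondr /= sum1_card.
  have snd_inj : {in [set y in M | y.1 == x.1] :\ x &, injective snd}.
    move=> [a1 b1] [a2 b2]; rewrite !inE /= => /and3P[_ _ /eqP->] /and3P[_ _ /eqP->].
    by move=> ->.
  rewrite -(card_in_imset snd_inj); apply/subset_leq_card/subsetP => b.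
  case/imsetP=> -[a' b']; rewrite in_setD1 inE /= => /and3P[ne_x yM /eqP eq_a] ->.
  have := subsetP (colored_sub k) _ yM; rewrite inE => /andP[_ b'B].
  rewrite unfold_in b'B -eq_a yM /=; apply: contraNneq ne_x => eq_b.
  by rewrite [x]surjective_pairing -eq_a -eq_b.
have le_deg2 (x : 'I_N * 'I_N) : x \in M ->
    (deg2 M x.2).-1 <= \sum_(a in sideA) (((a, x.2) \in M) && (a != x.1)).
  move=> xM; have xD : x \in [set y in M | y.2 == x.2] by rewrite inE xM eqxx.
  rewrite /deg2 (cardsD1 x) xD /= -big_mkcondr /= sum1_card.
  have fst_inj : {in [set y in M | y.2 == x.2] :\ x &, injective fst}.
    move=> [a1 b1] [a2 b2]; rewrite !inE /= => /and3P[_ _ /eqP->] /and3P[_ _ /eqP->].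
    by move=> ->.
  rewrite -(card_in_imset fst_inj); apply/subset_leq_card/subsetP => a.
  case/imsetP=> -[a' b']; rewrite in_setD1 inE /= => /and3P[ne_x yM /eqP eq_b] ->.
  have := subsetP (colored_sub k) _ yM; rewrite inE => /andP[a'A _].
  rewrite unfold_in a'A -eq_b yM /=; apply: contraNneq ne_x => eq_a.
  by rewrite [x]surjective_pairing -eq_a -eq_b.
apply: (@leq_trans (\sum_(x in M) \sum_(a in sideA) \sum_(b in sideB)
    [&& (x.1, b) \in M, b != x.2, (a, x.2) \in M & a != x.1])).
  apply: leq_sum => x xM; apply: leq_trans (leq_mul (le_deg1 x xM) (le_deg2 x xM)) _.
  rewrite big_distrlr /= exchange_big /=; apply/eq_leq.
  by apply: eq_bigr => a _; apply: eq_bigr => b _; rewrite mulnb -andbA.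
rewrite exchange_big /= mulnCA -sum_nat_const; apply: leq_sum => a _.
rewrite exchange_big /= mulnC -sum_nat_const; apply: leq_sum => b _.
rewrite -big_mkcondr /= sum1_card; apply: leq_trans (few_colored_paths k a b).
by apply/subset_leq_card/subsetP => x; rewrite inE.
Qed.

Lemma colored_bound k :
  #|colored k| < 6 * (#|sideA| + #|sideB|) \/ #|colored k| ^ 3 <= 128 * (#|sideA| * #|sideB|) ^ 2.
Proof.
case: leqP => [large|]; [right|by left].
apply: leq_trans (cube_card_le_path_count (colored_sub k) large) _.
apply: leq_trans (leq_mul (leqnn _) (colored_path_count k)) _.
by rewrite mulnACA -mulnn.
Qed.

Definition links : {set 'I_N * 'I_N} := [set x | [&& E x.1 x.2, E u x.2 & E x.1 v]].

Lemma card_links : #|links| <= #|sideA| + #|sideB| + \sum_k #|colored k|.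
Proof.
pose Lu := [set x in links | x.1 == u]; pose Lv := [set x in links | x.2 == v].
pose Lk := \bigcup_k colored k.
have sub : links \subset Lu :|: Lv :|: Lk.
  apply/subsetP => x; rewrite 2!in_setU !inE => /and3P[xE xu xv]; rewrite xE xu xv /=.
  case: (eqVneq x.1 u) => //= x1u; case: (eqVneq x.2 v) => //= x2v.
  by apply/bigcupP; exists (color x); rewrite ?inE ?xE ?xu ?xv ?x1u ?x2v /=.
apply: leq_trans (subset_leq_card sub) _.
apply: leq_trans (leq_card_setU _ _).1 (leq_add _ _); last first.
  rewrite /Lk; elim/big_rec2: _ => [|k m A _ le_m]; first by rewrite cards0.
  exact: leq_trans (leq_card_setU _ _).1 (leq_add (leqnn _) le_m).
rewrite addnC; apply: leq_trans (leq_card_setU _ _).1 (leq_add _ _).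
- rewrite -(card_in_imset (f := snd) (D := Lu)).
    by apply/subset_leq_card/subsetP => _ /imsetP[x /[!inE] /andP[/and3P[_ ub _] _] ->].
  by move=> [a1 b1] [a2 b2]; rewrite !inE /= => /andP[_ /eqP->] /andP[_ /eqP->] ->.
- rewrite -(card_in_imset (f := fst) (D := Lv)).
    by apply/subset_leq_card/subsetP => _ /imsetP[x /[!inE] /andP[/and3P[_ _ av] _] ->].
  by move=> [a1 b1] [a2 b2]; rewrite !inE /= => /andP[_ /eqP->] /andP[_ /eqP->] ->.
Qed.

End Color.
Definition edges : {set 'I_N * 'I_N} := [set x | E x.1 x.2].

Lemma deg1_edges u : deg1 edges u = #|sideB u|.
Proof.
rewrite -(card_imset (f := fun b => (u, b))); last by move=> b b' [].
apply: eq_card => -[a b]; rewrite !inE /=; apply/andP/imsetP => [[ab /eqP eq_a]|[b']].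
  by exists b; rewrite ?inE -?eq_a.
by rewrite inE => ub [-> ->].
Qed.

Lemma deg2_edges v : deg2 edges v = #|sideA v|.
Proof.
rewrite -(card_imset (f := fun a => (a, v))); last by move=> a a' [].
apply: eq_card => -[a b]; rewrite !inE /=; apply/andP/imsetP => [[ab /eqP eq_b]|[a']].
  by exists a; rewrite ?inE -?eq_b.
by rewrite inE => av [-> ->].
Qed.

Lemma sum_sideB : \sum_u #|sideB u| = #|edges|.
Proof.
rewrite -sum1_card (partition_big (fun x => x.1) predT) //=; apply: eq_bigr => u _.
by rewrite sum1dep_card -deg1_edges; apply: eq_card => x; rewrite !inE.
Qed.

Lemma sum_sideA : \sum_v #|sideA v| = #|edges|.
Proof.
rewrite -sum1_card (partition_big (fun x => x.2) predT) //=; apply: eq_bigr => v _.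
by rewrite sum1dep_card -deg2_edges; apply: eq_card => x; rewrite !inE.
Qed.

Lemma sum_links :
  \sum_(x in edges) deg1 edges x.1 * deg2 edges x.2 = \sum_u \sum_v #|links u v|.
Proof.
rewrite exchange_big /=.
transitivity (\sum_v \sum_u \sum_(x in edges) (E x.1 v * E u x.2)).
  rewrite (eq_bigr (fun v => \sum_(x in edges) \sum_u (E x.1 v * E u x.2))); last first.
    by move=> v _; rewrite exchange_big.
  rewrite exchange_big /=; apply: eq_bigr => x _; rewrite -big_distrlr /=.
  rewrite deg1_edges deg2_edges -!sum1_card -!big_mkcond /=.
  by congr (_ * _); rewrite !sum1_card; apply: eq_card => y; rewrite !inE.
apply: eq_bigr => v _; apply: eq_bigr => u _; rewrite -sum1_card [RHS]big_mkcond [LHS]big_mkcond /=.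
by apply: eq_bigr => x _; rewrite !inE; case: (E x.1 x.2); case: (E u x.2); case: (E x.1 v).
Qed.

Local Open Scope ring_scope.

Lemma edges_bound (R : realFieldType) : (#|edges|%:R ^+ 5 <= 2 ^+ 22 * N%:R ^+ 8 :> R)%R.
Proof.
pose sides (i : 'I_N * 'I_N * ((bool * bool) * (bool * bool))) :=
  (#|sideA i.1.2| * #|sideB i.1.1|)%N.
pose h (i : 'I_N * 'I_N * ((bool * bool) * (bool * bool))) := #|colored i.1.1 i.1.2 i.2|.
pose x i := if (h i ^ 3 <= 128 * sides i ^ 2)%N then h i else 0%N.
set e := #|edges|; set X := (\sum_i x i)%N.
have X_le : X%:R ^+ 3 <= 2 ^+ 19 * N%:R ^+ 2 * e%:R ^+ 4 :> R.
  have := @holder32 R _ predT (fun i => (x i)%:R) (fun i => (sides i)%:R) 128 (ler0n _ 128).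
  rewrite -!natr_sum -/X => /(_ (fun=> fun=> ler0n _ _) (fun=> fun=> ler0n _ _)) holder.
  apply: le_trans (holder _) _.
    move=> i _; rewrite -!natrX -natrM ler_nat /x; case: ifP => // _.
  have -> : (\sum_i sides i = 16 * e ^ 2)%N.
    rewrite -(pair_bigA _ (fun i k => sides (i, k))) /=.
    rewrite (eq_bigr (fun i => 16 * (#|sideA i.2| * #|sideB i.1|))%N); last first.
      by move=> i _; rewrite /sides /= sum_nat_const_type !card_prod !card_bool.
    rewrite -big_distrr /= -(pair_bigA _ (fun u v => (#|sideA v| * #|sideB u|)%N)) /=.
    congr (_ * _)%N; rewrite exchange_big -big_distrlr /= sum_sideA sum_sideB.
    by rewrite mulnn.
  rewrite !card_prod !card_ord !card_bool !natrM ?natrX.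
  by rewrite le_eqVlt; apply/orP; left; apply/eqP; ring.
have e3_le : (e ^ 3 <= N * N * (194 * (N * e) + X))%N.
  have := @cube_card_le_degree_product _ _ edges setT setT.
  rewrite -/e !cardsT !card_ord sum_links => /(_ _)/leq_trans; apply.
    by apply/subsetP => y; rewrite !inE.
  rewrite leq_mul2l; apply/orP; right.
  have links_le u v : (#|links u v| <=
      97 * (#|sideA v| + #|sideB u|) + \sum_k x ((u, v), k))%N.
    apply: leq_trans (card_links u v) _.
    have -> : (97 * (#|sideA v| + #|sideB u|) = #|sideA v| + #|sideB u| +
        \sum_(k : (bool * bool) * (bool * bool)) 6 * (#|sideA v| + #|sideB u|))%N.
      by rewrite sum_nat_const_type !card_prod !card_bool; lia.
    rewrite -[leqRHS]addnA leq_add2l -big_split /=; apply: leq_sum => k _.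
    rewrite /x /h /=; case: ifP => [_|/negbT]; first exact: leq_addl.
    by rewrite addn0; case: (colored_bound u v k) => [/ltnW//|->].
  apply: leq_trans (leq_sum _ (fun u _ => leq_sum _ (fun v _ => links_le u v))) _.
  rewrite (eq_bigr (fun u => \sum_v 97 * (#|sideA v| + #|sideB u|) + \sum_v \sum_k x ((u, v), k)))%N; last first.
    by move=> u _; rewrite big_split.
  rewrite big_split /= leq_add //; last first.
    by rewrite pair_bigA /= pair_bigA /=; apply/eq_leq/eq_bigr => -[[]].
  rewrite (eq_bigr (fun u => 97 * (e + N * #|sideB u|)))%N; last first.
    by move=> u _; rewrite -big_distrr big_split /= sum_sideA sum_nat_const_type card_ord.
  rewrite -big_distrr big_split /= sum_nat_const_type card_ord -big_distrr /= sum_sideB.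
  by rewrite -/e; lia.
have e_le : (e <= N * N)%N.
  by rewrite -[N]card_ord -card_prod max_card.
move: e3_le e_le; rewrite -!(@ler_nat R) !(natrX, natrD, natrM) => e3_le e_le.
apply: (fifth_power_bound (ler0n _ e) (ler0n _ N) (ler0n _ X) (ler0n _ 194) e3_le e_le X_le).
  have pow22 (y : R) : y ^+ 22 = (y * y ^+ 10) ^+ 2 by ring.
  rewrite pow22; have c_le : 194 <= 2 ^+ 10 :> R by rewrite -natrX ler_nat.
  apply: lerXn2r (ler_wpM2l _ c_le); rewrite ?nnegrE.
  - exact: mulr_ge0 (ler0n _ 2) (ler0n _ 194).
  - exact: mulr_ge0 (ler0n _ 2) (exprn_ge0 10 (ler0n _ 2)).
  - exact: ler0n.
have pow22 (y : R) : y ^+ 22 = y ^+ 3 * y ^+ 19 by ring.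
rewrite pow22; exact: lexx.
Qed.

End Forbidden.

Section LinkageBound.

Variables (T K : finType) (e : rel T) (c : bool -> seq T).
Variables (X : {set K}) (f : bool -> K -> T) (P : K -> seq T).
Hypothesis e_sym : symmetric e.
Hypothesis c_longest : forall b, longest_cycle e (c b).
Hypothesis cXfP : linkage e c [in X] f P.

Notation pos := (position c f).
Notation seg := (segment c f).

Lemma segment_le_common b x : seg b x <= #|[set t | (t \in c false) && (t \in c true)]|.
Proof.
have c_uniq : uniq (c b) by case: (c_longest b) => -[_ /andP[]].
apply: (@leq_trans (count [in c (~~ b)] (c b))).
  by rewrite -[X in _ <= count _ X](cat_take_drop (pos b x)) count_cat leq_addr.
rewrite -size_filter -(card_uniqP _) ?filter_uniq //.
apply/subset_leq_card/subsetP => t; rewrite mem_filter inE.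
by case: (b) => /= /andP[-> ->].
Qed.

Lemma linkage_bound (R : realFieldType) :
  (#|X|%:R ^+ 5 <= 2 ^+ 22 *
    #|[set t | (t \in c false) && (t \in c true)]|.+1%:R ^+ 8 :> R)%R.
Proof.
set k := #|[set t | _]|.
have [->|[x0 x0X]] := set_0Vmem X.
  by rewrite cards0 expr0n mulr_ge0 ?exprn_ge0 ?ler0n.
pose sg b x : 'I_k.+1 := inord (seg b x).
have sgE b x : val (sg b x) = seg b x.
  by rewrite /= inordK // ltnS; apply: segment_le_common.
pose link a b x := [&& x \in X, sg false x == a & sg true x == b].
pose E : rel 'I_k.+1 := fun a b => [exists x, link a b x].
pose xx a b := odflt x0 [pick x | link a b x].
have xxP a b : E a b -> [/\ xx a b \in X, sg false (xx a b) = a & sg true (xx a b) = b].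
  rewrite /E /xx => /existsP[x lx]; case: pickP => [y|/(_ x)]; last by rewrite lx.
  by case/and3P=> yX /eqP <- /eqP <-.
have segP a b : E a b -> seg false (xx a b) = val a /\ seg true (xx a b) = val b.
  by case/xxP=> _; rewrite -!sgE => -> ->.
have X_edges : #|X| <= #|edges E|.
  have inj : {in X &, injective (fun x => (sg false x, sg true x))}.
    move=> x y xX yX [eq_f eq_t]; apply: (no_digon e_sym c_longest cXfP) => // b.
    by rewrite -!sgE; case: b; rewrite ?eq_f ?eq_t.
  rewrite -(card_in_imset inj); apply/subset_leq_card/subsetP => _ /imsetP[x xX ->].
  by rewrite inE /=; apply/existsP; exists x; rewrite /link xX !eqxx.
have bound := @edges_bound k.+1 E (fun a b => pos false (xx a b))
  (fun a b => pos true (xx a b)) _ _ _ _ _ _ R.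
apply: le_trans (bound _ _ _ _ _ _); rewrite ?lerXn2r ?nnegrE ?ler0n ?ler_nat //.
- move=> a b a' b' ab a'b' lt_a; apply: position_lt_segment.
  by rewrite (segP _ _ ab).1 (segP _ _ a'b').1.
- move=> a b a' b' ab a'b' lt_b; apply: position_lt_segment.
  by rewrite (segP _ _ ab).2 (segP _ _ a'b').2.
- move=> a b b' ab ab'; have [xX _ def_b] := xxP _ _ ab; have [yX _ def_b'] := xxP _ _ ab'.
  by move/(position_inj cXfP xX yX) => eq_x; rewrite -def_b' -eq_x def_b.
- move=> a a' b ab a'b; have [xX def_a _] := xxP _ _ ab; have [yX def_a' _] := xxP _ _ a'b.
  by move/(position_inj cXfP xX yX) => eq_x; rewrite -def_a' -eq_x def_a.
- move=> a a' b b' aa' bb' ab ab' a'b a'b'.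
  have [s00 t00] := segP _ _ ab; have [s01 t01] := segP _ _ ab'.
  have [s10 t10] := segP _ _ a'b; have [s11 t11] := segP _ _ a'b'.
  apply: (no_quad e_sym c_longest cXfP); rewrite ?s00 ?s01 ?s10 ?s11 ?t00 ?t01 ?t10 ?t11 //=.
  have [x00 _ _] := xxP _ _ ab; have [x01 _ _] := xxP _ _ ab'.
  have [x10 _ _] := xxP _ _ a'b; have [x11 _ _] := xxP _ _ a'b'.
  by rewrite x00 x01 x10 x11.
- move=> a b segs1 ord1 segs2 ord2 t1 t2 Eab ab_inj segs1P segs2P ord1P ord2P.
  apply: (no_cube e_sym c_longest cXfP) => //.
  + move=> i j /Eab ab; have [xX _ _] := xxP _ _ ab; have [s t] := segP _ _ ab.
    by rewrite xX s t.
  + move=> i j i4 j4; have [a_inj b_inj] := ab_inj i j i4 j4.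
    by split=> [/val_inj|/val_inj].
Qed.

End LinkageBound.

(** * Menger's theorem *)

Section Walks.

Variable T : finType.
Implicit Types (e : rel T) (A B S : {set T}) (x y t : T) (p : seq T).

Definition walk e A x p : bool :=
  if p is a :: q then [&& a \in A, path e a q & last a q == x] else false.

Lemma walk_rcons e A x p t : walk e A x (rcons p t) = walk e A t (rcons p t) && (t == x).
Proof.
case: p => [|a p] /=; first by rewrite eqxx andbT.
by rewrite last_rcons eqxx andbT -andbA.
Qed.

Lemma walk_prefix e A x p1 t p2 : walk e A x (rcons p1 t ++ p2) -> walk e A t (rcons p1 t).
Proof.
case: p1 => [|a p1] /=; first by rewrite eqxx andbT => /and3P[->].
by rewrite cat_path last_rcons eqxx andbT => /and3P[-> /andP[-> _]].
Qed.

Lemma walk_suffix e A x p1 t p2 : walk e A x (p1 ++ t :: p2) -> walk e [set t] x (t :: p2).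
Proof.
case: p1 => [|a p1] /=; first by rewrite set11 => /and3P[_ -> ->].
by rewrite set11 cat_path last_cat /= => /and3P[_ /and3P[_ _ ->] ->].
Qed.

Lemma walk_cat e A x p1 t p2 :
  walk e A t (rcons p1 t) -> walk e [set t] x (t :: p2) -> walk e A x (rcons p1 t ++ p2).
Proof.
case: p1 => [|a p1] /=; first by case/andP=> -> _ /and3P[_ -> ->].
rewrite cat_path last_cat !last_rcons => /and3P[-> -> _] /and3P[_ -> ->].
by [].
Qed.

Lemma walk_edge e A x p1 s t p2 :
  walk e A s (rcons p1 s) -> e s t -> walk e [set t] x (t :: p2) ->
  walk e A x (rcons p1 s ++ t :: p2).
Proof.
case: p1 => [|a p1] /=; first by case/andP=> -> _ -> /and3P[_ -> ->].
rewrite cat_path last_cat !last_rcons /= => /and3P[-> -> _] -> /and3P[_ -> ->].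
by [].
Qed.

Lemma walk_sub e A B x y p : A \subset B -> x = y -> walk e A x p -> walk e B y p.
Proof. by move=> /subsetP AB <-; case: p => //= a p /and3P[/AB-> -> ->]. Qed.

Lemma walk_last e A x p : walk e A x p -> exists p', p = rcons p' x.
Proof.
case/lastP: p => // p t; rewrite walk_rcons => /andP[_ /eqP->].
by exists p.
Qed.

Lemma walk_head e A x p : walk e A x p -> exists2 a, a \in A & exists p', p = a :: p'.
Proof. by case: p => // a p /and3P[aA _ _]; exists a => //; exists p. Qed.

Definition separates e A B S : Prop :=
  forall x p, x \in B -> walk e A x p -> has [in S] p.

Definition remove_edge e x y : rel T := fun s t => e s t && ((s, t) != (x, y)).

Lemma remove_edge_sub e x y A s p : walk (remove_edge e x y) A s p -> walk e A s p.
Proof.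
case: p => //= a p /and3P[-> + ->]; rewrite andbT.
by apply: sub_path => ? ? /andP[].
Qed.

Lemma walk_remove_edge_last e x y A t p :
  x \notin p -> walk e A t (rcons p t) -> walk (remove_edge e x y) A t (rcons p t).
Proof.
case: p => [|a p] //=; rewrite inE negb_or => /andP[xa xp] /and3P[-> + ->].
rewrite andbT /=; elim: p a xa xp => [|b p IHp] a xa xp /=.
  by rewrite /remove_edge xpair_eqE [a == x]eq_sym (negPf xa) !andbT.
move: xp; rewrite inE negb_or => /andP[xb xp] /andP[ab /(IHp b xb xp)->].
by rewrite /remove_edge ab xpair_eqE [a == x]eq_sym (negPf xa).
Qed.

Lemma walk_remove_edge_head e x y A s t p :
  y \notin p -> walk e A t (s :: p) -> walk (remove_edge e x y) A t (s :: p).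
Proof.
move=> + /= /and3P[-> + ->]; rewrite andbT /=; elim: p s => [|b p IHp] s //=.
rewrite inE negb_or => /andP[yb yp] /andP[sb /(IHp b yp)->].
by rewrite /remove_edge sb xpair_eqE [b == y]eq_sym (negPf yb) andbF.
Qed.

Lemma split_last_has (a : pred T) p : has a p ->
  exists p1 t p2, [/\ p = p1 ++ t :: p2, a t & ~~ has a p2].
Proof.
elim: p => //= t p IHp; case: (boolP (has a p)) => [/IHp[p1 [u [p2 [-> au p2a]]]] _|p_a].
  by exists (t :: p1), u, p2.
by rewrite orbF => at_; exists [::], t, p.
Qed.

Definition disjoint_walks e A (X : {set T}) (P : T -> seq T) : Prop :=
  {in X, forall x, walk e A x (P x) && uniq (P x)} /\
  {in X &, forall x y t, t \in P x -> t \in P y -> x = y}.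

Lemma separates_src e x y A B S :
  separates (remove_edge e x y) A B S -> separates e A B (x |: S).
Proof.
move=> sepS b p bB wp; case: (boolP (x \in p)) => [xp|x_p].
  by apply/hasP; exists x => //; apply: setU11.
have [p' def_p] := walk_last wp; have := sepS b p bB.
rewrite def_p in wp x_p *; rewrite mem_rcons inE negb_or in x_p.
case/andP: x_p => _ x_p /(_ (walk_remove_edge_last y x_p wp)).
by apply: sub_has => t tS; rewrite inE tS orbT.
Qed.

Lemma separates_tgt e x y A B S :
  separates (remove_edge e x y) A B S -> separates e A B (y |: S).
Proof.
move=> sepS b p bB wp; case: (boolP (y \in p)) => [yp|y_p].
  by apply/hasP; exists y => //; apply: setU11.
have [a aA [p' def_p]] := walk_head wp; have := sepS b p bB.
rewrite def_p in wp y_p *; rewrite inE negb_or in y_p.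
case/andP: y_p => _ y_p /(_ (walk_remove_edge_head x y_p wp)).
by apply: sub_has => t tS; rewrite inE tS orbT.
Qed.

Lemma separates_prefix e x y A B S Z : separates e A B (x |: S) ->
  separates (remove_edge e x y) A (x |: S) Z -> separates e A B Z.
Proof.
move=> sepS sepZ b p bB wp; have /split_find := sepS b p bB wp.
move=> split_p; case: split_p wp => t p1 p2 tS p1S wp.
have x_p1 : x \notin p1 by apply: contraNN p1S => xp1; apply/hasP; exists x => //; apply: setU11.
have := sepZ t _ tS (walk_remove_edge_last y x_p1 (walk_prefix wp)).
by rewrite has_cat => ->.
Qed.

Lemma separates_suffix e x y A B S Z : separates e A B (y |: S) ->
  separates (remove_edge e x y) (y |: S) B Z -> separates e A B Z.
Proof.
move=> sepS sepZ b p bB wp; have [p1 [t [p2 [def_p tS p2S]]]] := split_last_has (sepS b p bB wp).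
have y_p2 : y \notin p2 by apply: contraNN p2S => yp2; apply/hasP; exists y => //; apply: setU11.
rewrite def_p in wp *; have := walk_remove_edge_head x y_p2 (walk_suffix wp).
move/(walk_sub (B := y |: S) _ erefl); rewrite sub1set => /(_ tS)/(sepZ b _ bB).
by rewrite has_cat => ->; rewrite orbT.
Qed.

(* Göring's proof: if a separator [S] with fewer than [k] vertices appears when the edge [xy] is
   removed, then [x |: S] and [y |: S] both have [k] elements; linkages into the former and out of
   the latter meet only in [S], and are joined there and along [xy]. *)
Lemma menger e A B k : (forall S, separates e A B S -> k <= #|S|) ->
  exists (X : {set T}) (P : T -> seq T), [/\ X \subset B, #|X| = k & disjoint_walks e A X P].
Proof.
have [n] := ubnP #|[set xy : T * T | e xy.1 xy.2]|.
elim: n e A B => // n IHn e A B; rewrite ltnS => e_n minsep.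
case: (pickP (fun xy : T * T => e xy.1 xy.2)) => [[x y] /= exy | e0]; last first.
  have /card_geqP[s [s_uniq s_size s_AB]] : k <= #|A :&: B|.
    apply: minsep => x [|a [|b p]] //= xB; last by rewrite (e0 (a, b)) andbF.
    by rewrite inE => /andP[-> /eqP->]; rewrite xB.
  exists [set x in s], (fun x => [:: x]); split.
  - by apply/subsetP => x; rewrite inE => /s_AB /setIP[].
  - by rewrite cardsE (card_uniqP s_uniq).
  - split=> [x|x y _ _ t]; last by rewrite !inE => /eqP-> /eqP->.
    by rewrite !inE => /s_AB /setIP[xA _]; rewrite /= xA eqxx.
pose e' := remove_edge e x y.
have e'_n : #|[set xy : T * T | e' xy.1 xy.2]| < n.
  apply: leq_trans e_n; apply: proper_card; apply/properP; split.
    by apply/subsetP => -[s t]; rewrite !inE => /andP[].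
  by exists (x, y); rewrite !inE //= /e' /remove_edge eqxx andbF.
have [minsep'|/existsNP[S /not_implyP[sepS S_lt]]] :=
    EM (forall S, separates e' A B S -> k <= #|S|).
  have [X [P [XB Xk [P_walk P_disj]]]] := IHn e' A B e'_n minsep'.
  exists X, P; split=> //; split=> // z zX.
  by have /andP[/remove_edge_sub-> ->] := P_walk z zX.
have sep_x := separates_src sepS; have sep_y := separates_tgt sepS.
have [xS kx] : x \notin S /\ k = #|x |: S|.
  have := minsep _ sep_x; move/negP: S_lt; rewrite -ltnNge cardsU1.
  by case: (x \in S) => /= lt_S le_k; [exfalso|split=> //]; lia.
have [yS ky] : y \notin S /\ k = #|y |: S|.
  have := minsep _ sep_y; move/negP: S_lt; rewrite -ltnNge cardsU1.
  by case: (y \in S) => /= lt_S le_k; [exfalso|split=> //]; lia.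
have [X1 [P1 [X1S X1k [P1_walk P1_disj]]]] :=
  IHn e' A (x |: S) e'_n (fun Z sepZ => minsep Z (separates_prefix sep_x sepZ)).
have [X2 [P2 [X2B X2k [P2_walk P2_disj]]]] :=
  IHn e' (y |: S) B e'_n (fun Z sepZ => minsep Z (separates_suffix sep_y sepZ)).
have {X1S} def_X1 : X1 = x |: S by apply/eqP; rewrite eqEcard X1S -kx X1k leqnn.
pose hd z := head z (P2 z).
have P2E z : z \in X2 -> P2 z = hd z :: behead (P2 z) /\ hd z \in y |: S.
  by case/P2_walk/andP=> /walk_head[a aS [p' def_p]] _; rewrite /hd def_p.
have hd_mem z : z \in X2 -> hd z \in P2 z by case/P2E=> -> _; apply: mem_head.
have hd_onto s : s \in y |: S -> exists2 z, z \in X2 & hd z = s.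
  have hd_inj : {in X2 &, injective hd}.
    by move=> z z' zX z'X eq_hd; apply: (P2_disj z z' zX z'X (hd z)); rewrite ?hd_mem // eq_hd hd_mem.
  have -> : y |: S = hd @: X2.
    apply/esym/eqP; rewrite eqEcard card_in_imset // X2k -ky leqnn andbT.
    by apply/subsetP => _ /imsetP[z /P2E[_ hS] ->].
  by case/imsetP=> z zX ->; exists z.
have last_mem s : s \in X1 -> s \in P1 s.
  by case/P1_walk/andP=> /walk_last[p' ->] _; rewrite mem_rcons mem_head.
have hd_unique s z : s \in S -> z \in X2 -> s \in P2 z -> hd z = s.
  move=> sS zX sz; have [|z' z'X def_s] := hd_onto s; first by rewrite inE sS orbT.
  by rewrite (P2_disj z z' zX z'X s) // -def_s hd_mem.
have cross s z t : s \in X1 -> z \in X2 -> t \in P1 s -> t \in P2 z ->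
    [/\ t \in S, t = s & hd z = t].
  move=> sX zX tP1 tP2; suff [tS ts] : t \in S /\ t = s by split=> //; apply: hd_unique.
  have /andP[w1 u1] := P1_walk s sX; have /andP[w2 u2] := P2_walk z zX.
  have [p1 [p2 def1]] : exists p1 p2, P1 s = rcons p1 t ++ p2.
    by case/splitPr: tP1 => p1 p2; exists p1, p2; rewrite cat_rcons.
  have [q1 [q2 def2]] : exists q1 q2, P2 z = q1 ++ t :: q2.
    by case/splitPr: tP2 => q1 q2; exists q1, q2.
  have w : walk e' A z (rcons p1 t ++ q2).
    apply: walk_cat; first by apply: (walk_prefix (x := s) (p2 := p2)); rewrite -def1.
    by apply: (walk_suffix (A := y |: S) (p1 := q1)); rewrite -def2.
  case/hasP: (sepS z _ (subsetP X2B z zX) w) => r; rewrite mem_cat => /orP[] r_in rS.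
    have rs : r = s.
      apply: (P1_disj r s _ sX r); rewrite ?last_mem ?def_X1 ?inE ?rS ?orbT //.
      by rewrite def1 mem_cat r_in.
    rewrite rs in r_in rS; have [p' def1'] := walk_last w1.
    suff st : t = s by rewrite st.
    case/lastP: p2 def1 => [|p2 v] def1.
      by move: def1; rewrite cats0 def1' => /rcons_inj[_ ->].
    have vs : v = s by move: def1; rewrite def1' -rcons_cat => /rcons_inj[_ ->].
    move: u1; rewrite def1 cat_uniq vs => /and3P[_ /hasPn/(_ s)].
    by rewrite mem_rcons mem_head => /(_ isT); rewrite /= r_in.
  have r_hd : hd z = r by apply: hd_unique; rewrite // def2 mem_cat inE r_in !orbT.
  have : hd z \in rcons q1 t by rewrite /hd def2; case: (q1) => [|v q1'] /=; rewrite mem_head.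
  move: u2; rewrite def2 -cat_rcons cat_uniq r_hd => /and3P[_ /hasPn/(_ r r_in)].
  by move=> /negP.
pose src z := if hd z == y then x else hd z.
have srcX z : z \in X2 -> src z \in X1.
  case/P2E=> _; rewrite /src def_X1 !inE; case: eqP => [_|_ /= ->]; first by rewrite eqxx.
  by rewrite orbT.
pose Q z := P1 (src z) ++ (if hd z == y then P2 z else behead (P2 z)).
have Q_mem z t : z \in X2 -> t \in Q z -> t \in P1 (src z) \/ t \in P2 z.
  move=> zX; rewrite mem_cat => /orP[]; first by left.
  by case: ifP => _; [right|move/mem_behead; right].
have src_inj : {in X2 &, forall z z', src z = src z' -> z = z'}.
  have hd_inj : {in X2 &, injective hd}.
    by move=> z z' zX z'X eq_hd; apply: (P2_disj z z' zX z'X (hd z)); rewrite ?hd_mem // eq_hd hd_mem.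
  move=> z z' zX z'X; rewrite /src.
  case: eqP => [hz|/eqP hy]; case: eqP => [hz'|/eqP hy'].
  - by move=> _; apply: hd_inj; rewrite ?hz.
  - by move=> eq_x; have [_] := P2E z' z'X; rewrite !inE (negPf hy') -eq_x (negPf xS).
  - by move=> eq_x; have [_] := P2E z zX; rewrite !inE (negPf hy) eq_x (negPf xS).
  - by move/hd_inj; apply.
exists X2, Q; split=> //; split=> [z zX|z z' zX z'X t].
  have /andP[w1 u1] := P1_walk _ (srcX z zX); have /andP[w2 u2] := P2_walk z zX.
  have [def_P2 hS] := P2E z zX.
  apply/andP; split.
    have [p1 def1] := walk_last w1.
    have w1' : walk e A (src z) (rcons p1 (src z)) by rewrite -def1; apply: remove_edge_sub w1.
    have w2' : walk e [set hd z] z (hd z :: behead (P2 z)).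
      apply: (walk_suffix (A := y |: S) (p1 := [::])).
      by rewrite cat0s -def_P2; apply: remove_edge_sub w2.
    rewrite /Q def1; case: (eqVneq (hd z) y) => [hy|hy].
      by rewrite def_P2; apply: walk_edge w1' _ w2'; rewrite /src hy eqxx.
    have eq_src : src z = hd z by rewrite /src (negPf hy).
    by move: w1'; rewrite eq_src => w1'; apply: walk_cat w1' w2'.
  rewrite /Q cat_uniq u1 /=; apply/andP; split; last first.
    by case: ifP => // _; move: u2; rewrite def_P2 => /andP[].
  apply/hasPn => t tP2; apply/negP => /= tP1.
  have tP2' : t \in P2 z by move: tP2; case: ifP => // _ /mem_behead.
  have [tS t_src t_hd] := cross _ _ _ (srcX z zX) zX tP1 tP2'.
  move: tP2; case: eqP => [hy|_]; first by rewrite -t_hd hy (negPf yS) in tS.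
  by move: u2; rewrite def_P2 -t_hd /= => /andP[/negP].
move=> /(Q_mem _ _ zX)[] tz /(Q_mem _ _ z'X)[] tz'.
- by apply: src_inj => //; apply: P1_disj tz tz'; apply: srcX.
- have [tS t_src t_hd] := cross _ _ _ (srcX z zX) z'X tz tz'.
  apply: src_inj => //; rewrite -t_src /src t_hd; case: eqP => // ty.
  by rewrite ty (negPf yS) in tS.
- have [tS t_src t_hd] := cross _ _ _ (srcX z' z'X) zX tz' tz.
  apply: src_inj => //; rewrite -t_src /src t_hd; case: eqP => // ty.
  by rewrite ty (negPf yS) in tS.
- exact: P2_disj tz tz'.
Qed.

End Walks.

Lemma walk_trim (T : finType) (e : rel T) (A B : {set T}) x p :
  walk e A x p -> x \in B -> uniq p -> ~~ has [in A :&: B] p ->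
  exists a q b, [/\ a \in A :\: B, b \in B :\: A, path e a (rcons q b), uniq q &
    ~~ has [in A :|: B] q] /\ {subset a :: rcons q b <= p}.
Proof.
move=> wp xB p_uniq p_AB.
have : has [in B] p
  by apply/hasP; exists x => //; have [p' ->] := walk_last wp; rewrite mem_rcons mem_head.
move=> /split_find split_p; case: split_p p_uniq p_AB wp => b p1 p2 bB p1B p_uniq p_AB wp.
have wp1 := walk_prefix wp.
have notAB t : t \in rcons p1 b -> t \in A -> t \in B -> False.
  by move=> tp tA tB; case/hasP: p_AB; exists t; rewrite ?inE ?tA // mem_cat tp.
have p1A : has [in A] p1.
  case: (p1) wp1 notAB => [|a p1'] /= /andP[aA _] notAB; last by rewrite /= aA.
  by case: (notAB b); rewrite ?mem_head.
have [r [a [q [def_p1 aA qA]]]] := split_last_has p1A.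
have sub : {subset a :: rcons q b <= rcons p1 b}.
  by move=> t; rewrite def_p1 rcons_cat mem_cat => ->; rewrite orbT.
exists a, q, b; split; last by move=> t /sub tp; rewrite mem_cat tp.
split.
- by rewrite inE aA andbT; apply/negP; apply: notAB aA; rewrite sub ?mem_head.
- rewrite inE bB andbT; apply/negP => bA.
  by apply: notAB bA bB; rewrite mem_rcons mem_head.
- by move: wp1; rewrite def_p1 rcons_cat => /walk_suffix /= /and3P[].
- move: p_uniq; rewrite cat_uniq rcons_uniq def_p1 => /andP[/andP[_]].
  by rewrite cat_uniq /= => /and3P[_ _ /andP[]].
- apply/hasPn => t tq; rewrite !inE negb_or (hasPn qA t tq) (hasPn p1B) //.
  by rewrite def_p1 mem_cat inE tq !orbT.
Qed.

Section Separators.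

Variables (T : finType) (e : rel T) (c : bool -> seq T).
Hypothesis e_sym : symmetric e.
Hypothesis c_longest : forall b, longest_cycle e (c b).

Let C b : {set T} := [set t in c b].

Lemma menger_linkage k : (forall S, separates e (C false) (C true) S -> k <= #|S|) ->
  exists (X : {set T}) f P, linkage e c [in X] f P /\ k <= #|X| + #|C false :&: C true|.
Proof.
case/menger=> X [W [XB Xk [W_walk W_disj]]].
pose I := C false :&: C true; pose X' := [set x in X | ~~ has [in I] (W x)].
pose trimmed x (r : T * seq T * T) := x \in X' -> let: (a, q, b) := r in
  [/\ a \in C false :\: C true, b \in C true :\: C false, path e a (rcons q b), uniq q &
      ~~ has [in C false :|: C true] q] /\ {subset a :: rcons q b <= W x}.
have /choice[r rP] : forall x, exists r, trimmed x r.
  move=> x; case: (boolP (x \in X')) => [|xX']; last by exists (x, [::], x) => xX; rewrite xX in xX'.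
  rewrite inE => /andP[xX WI]; have /andP[w u] := W_walk x xX.
  by have [a [q [b spec]]] := walk_trim w (subsetP XB x xX) u WI; exists (a, q, b).
pose f b x := if b then (r x).2 else (r x).1.1; pose P x := (r x).1.2.
have rE x : r x = (f false x, P x, f true x) by rewrite /f /P; case: (r x) => -[].
have X'X x : x \in X' -> x \in X by rewrite inE => /andP[].
have spec x : x \in X' -> [/\ f false x \in C false :\: C true, f true x \in C true :\: C false,
    path e (f false x) (rcons (P x) (f true x)), uniq (P x) &
      ~~ has [in C false :|: C true] (P x)] /\ {subset f false x :: rcons (P x) (f true x) <= W x}.
  by move=> xX; have := rP x xX; rewrite rE.
exists X', f, P; split; first split.
- by move=> b x /spec[[+ + _ _ _] _]; rewrite !inE => /andP[_ ?] /andP[_ ?]; case: b.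
- by move=> b x /spec[[+ + _ _ _] _]; rewrite !inE => /andP[? _] /andP[? _]; case: b.
- by move=> x /spec[[]].
- by move=> x /spec[[]].
- move=> b x /spec[[_ _ _ _ /hasPn P_out] _] t /P_out; rewrite /= !inE negb_or => /andP[].
  by case: b.
- move=> x y xX yX t tx ty; have [_ subx] := spec x xX; have [_ suby] := spec y yX.
  apply: (W_disj x y (X'X x xX) (X'X y yX) t); [apply: subx|apply: suby].
    by rewrite inE mem_rcons inE tx !orbT.
  by rewrite inE mem_rcons inE ty !orbT.
- move=> b x y xX yX eq_f; have [_ subx] := spec x xX; have [_ suby] := spec y yX.
  apply: (W_disj x y (X'X x xX) (X'X y yX) (f b x)); [apply: subx|rewrite eq_f; apply: suby].
    by case: (b); rewrite !(inE, mem_rcons) eqxx ?orbT.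
  by case: (b); rewrite !(inE, mem_rcons) eqxx ?orbT.
rewrite -Xk -(cardsID X' X); apply: leq_add; first by apply: subset_leq_card; apply: subsetIr.
pose g x := odflt x [pick t in W x | t \in I].
have gP x : x \in X :\: X' -> g x \in W x /\ g x \in I.
  rewrite 2!inE => /andP[xX' xX]; have : has [in I] (W x) by move: xX'; rewrite xX /= negbK.
  case/hasP=> t tW tI; rewrite /g; case: pickP => [u /andP[]//|/(_ t)].
  by rewrite tW tI.
have g_inj : {in X :\: X' &, injective g}.
  move=> x y xX yX eq_g; have [gx _] := gP x xX; have [gy _] := gP y yX.
  move: xX yX; rewrite !in_setD => /andP[_ xX] /andP[_ yX].
  by apply: (W_disj x y xX yX (g x)); rewrite // eq_g.
rewrite -(card_in_imset g_inj); apply/subset_leq_card/subsetP => _ /imsetP[x /gP[_ gI] ->].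
exact: gI.
Qed.

End Separators.

(** * Cycles in vertex-transitive graphs *)

Section VertexTransitive.

Variables (T : finType) (e : rel T).
Hypothesis e_simple : simple_graph e.
Hypothesis e_conn : connected_graph e.
Hypothesis e_trans : vertex_transitive e.
Hypothesis T_ge3 : 2 < #|T|.

Let e_sym : symmetric e. Proof. by case: e_simple. Qed.

Definition avoiding (r : T) : rel T := fun x y => [&& e x y, x != r & y != r].

Lemma avoiding_sym r : symmetric (avoiding r).
Proof. by move=> x y; rewrite /avoiding e_sym [(x != r) && _]andbC. Qed.

Lemma connect_avoiding_neq r x y : x != r -> connect (avoiding r) x y -> y != r.
Proof.
move=> xr /connectP[p + ->]; elim: p x xr => //= y' p IHp x xr /andP[/and3P[_ _ y'r]].
exact: IHp.
Qed.

Lemma neighbor_of_component r o : o != r ->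
  exists2 x, connect (avoiding r) o x & e x r.
Proof.
move=> or; apply: contrapT => no_edge.
have closed_comp : closed e [pred x | connect (avoiding r) o x].
  apply: intro_closed => [|x y xy]; first exact: sym_connect_sym.
  rewrite !inE => ox; apply: connect_trans (ox) (connect1 _).
  have yr : y != r by apply: contra_notN no_edge => /eqP yr; exists x => //; rewrite -yr.
  by rewrite /avoiding xy yr (connect_avoiding_neq or ox).
have := closed_connect closed_comp (e_conn.2 o r); rewrite !inE connect0 => /esym.
by move/(connect_avoiding_neq or); rewrite eqxx.
Qed.

(* Remove a vertex so that the largest remaining component is as large as possible: a vertex
   outside of this component could be removed instead. *)
Lemma exists_noncut :
  exists r, forall x y, x != r -> y != r -> connect (avoiding r) x y.
Proof.
have [x0 [y0 xy0]] : exists x0 y0 : T, y0 != x0.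
  have /card_gt1P[x0 [y0 [_ _ xy]]] : 1 < #|{: T}| by apply: ltnW.
  by exists y0, x0.
pose comp (ro : T * T) := [set z | connect (avoiding ro.1) ro.2 z].
have [[r o] /= or max_ro] := @arg_maxnP _ (x0, y0) (fun ro : T * T => ro.2 != ro.1)
  (fun ro => #|comp ro|) xy0.
have all_comp z : z != r -> connect (avoiding r) o z.
  move=> zr; apply: contraT => oz.
  have oz' : o != z by apply: contraNneq oz => ->.
  have sub : comp (r, o) \subset comp (z, o).
    apply/subsetP => w; rewrite !inE /= => /connectP[p + ->].
    elim/last_ind: p => [|p w' IHp]; first by rewrite connect0.
    rewrite rcons_path last_rcons => /andP[p_path edge].
    have ow' : connect (avoiding r) o w'.
      by apply/connectP; exists (rcons p w'); rewrite ?rcons_path ?p_path // last_rcons.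
    have ow : connect (avoiding r) o (last o p) by apply/connectP; exists p.
    apply: connect_trans (IHp p_path) (connect1 _); case/and3P: edge => edge _ _.
    by rewrite /avoiding edge /=; apply/andP; split; apply: contraNneq oz => <-.
  have [x ox xr] := neighbor_of_component or.
  have r_in : r \in comp (z, o).
    have : x \in comp (z, o) by apply: (subsetP sub); rewrite inE.
    rewrite !inE /= => /connect_trans; apply; apply: connect1.
    rewrite /avoiding xr [r == z]eq_sym zr andbT /=; apply: contraNneq oz => <-; exact: ox.
  have r_out : r \notin comp (r, o).
    by rewrite inE /=; apply/negP => /(connect_avoiding_neq or); rewrite eqxx.
  have : #|comp (r, o)| < #|comp (z, o)|.
    by apply: proper_card; apply/properP; split=> //; exists r.
  by rewrite ltnNge max_ro.
exists r => x y xr yr; apply: connect_trans (all_comp y yr).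
by rewrite (sym_connect_sym (avoiding_sym r)) all_comp.
Qed.

Lemma no_cut_vertex r x y : x != r -> y != r -> connect (avoiding r) x y.
Proof.
have [r0 r0_ok] := exists_noncut; have [g g_auto g_r0] := e_trans r0 r.
move=> xr yr; pose x' := (g^-1)%g x; pose y' := (g^-1)%g y.
have neq z : z != r -> (g^-1)%g z != r0 by apply: contraNneq => eq_z; rewrite -g_r0 -eq_z permKV.
have /connectP[p p_path last_p] := r0_ok x' y' (neq x xr) (neq y yr).
apply/connectP; exists (map g p); last by rewrite -(permKV g x) last_map -last_p permKV.
rewrite -(permKV g x) path_map; apply: sub_path p_path => s t /and3P[st sr tr].
by rewrite /= /avoiding g_auto st -g_r0 !(inj_eq perm_inj) sr tr.
Qed.

Lemma exists_two_neighbors x : exists y z, [/\ y != z, e x y & e x z].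
Proof.
suff [w [y [z [yz wy wz]]]] : exists w y z, [/\ y != z, e w y & e w z].
  have [g g_auto g_w] := e_trans w x.
  by exists (g y), (g z); rewrite -g_w !g_auto (inj_eq perm_inj).
apply: contrapT => deg1.
have uniq_nbr a b b' : e a b -> e a b' -> b = b'.
  by move=> ab ab'; apply: contrapT => /eqP bb'; apply: deg1; exists a, b, b'.
have [y xy] : exists y, e x y.
  have /existsP[z /andP[zx _]] : [exists z, (z != x) && true].
    have /card_gt1P[a [b [_ _ ab]]] : 1 < #|{: T}| by apply: ltnW.
    by apply/existsP; case: (eqVneq a x) => [<-|ax]; [exists b; rewrite eq_sym ab|exists a; rewrite ax].
  case/connectP: (e_conn.2 x z) => -[|y p] /=; first by move=> _ zx'; rewrite zx' eqxx in zx.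
  by case/andP=> xy _ _; exists y.
have closed_xy : closed e [set x; y].
  apply: intro_closed => [|a b ab]; first exact: sym_connect_sym.
  rewrite !inE => /orP[] /eqP def_a; rewrite def_a in ab.
    by rewrite (uniq_nbr _ _ _ ab xy) eqxx orbT.
  by rewrite e_sym in xy; rewrite (uniq_nbr _ _ _ ab xy) eqxx.
have : #|{: T}| <= #|[set x; y]|.
  apply: subset_leq_card; apply/subsetP => z _.
  by rewrite -(closed_connect closed_xy (e_conn.2 x z)) !inE eqxx.
by rewrite cards2 => /(leq_trans T_ge3); case: (x != y).
Qed.

Lemma exists_cycle : exists s, graph_cycle e s.
Proof.
pose Q m := `[< exists x q, [/\ path e x q, uniq (x :: q) & size q = m] >].
have [x0 _] : exists x0 : T, true by have /card_gt0P[x0 _] := e_conn.1; exists x0.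
have Q0 : exists m, Q m by exists 0; apply/asboolP; exists x0, [::].
have Q_le m : Q m -> m <= #|T|.
  move/asboolP=> [x [q [_ xq_uniq <-]]]; apply: ltnW.
  by rewrite -[_.+1]/(size (x :: q)) -(card_uniqP xq_uniq) max_card.
have [m /asboolP[x [q [xq xq_uniq size_q]]] m_max] := ex_maxnP Q0 Q_le.
have nbr_in y : e x y -> y \in q.
  move=> xy; apply: contraT => yq; have : Q m.+1.
    apply/asboolP; exists y, (x :: q); split; last by rewrite /= size_q.
    - by rewrite /= e_sym xy.
    - rewrite cons_uniq xq_uniq inE negb_or yq !andbT.
      by apply: contraTneq xy => ->; case: e_simple => _ ->.
  by move/m_max; rewrite ltnn.
have [y [z [yz xy xz]]] := exists_two_neighbors x.
wlog lt_yz : y z yz xy xz / index y q < index z q.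
  move=> gen; case: (ltngtP (index y q) (index z q)) => [lt|lt|eq_i].
  - exact: (gen y z).
  - by apply: (gen z y); rewrite // eq_sym.
  - by case/eqP: yz; rewrite -(nth_index x (nbr_in y xy)) eq_i nth_index ?nbr_in.
have q_uniq : uniq q by case/andP: xq_uniq.
have [p1 [p2 [p3 def_q]]] := split_two q_uniq (nbr_in z xz) lt_yz.
exists (x :: p1 ++ y :: rcons p2 z); split; first by rewrite /= size_cat /= size_rcons !addnS.
have def_q' : q = (p1 ++ y :: rcons p2 z) ++ p3 by rewrite def_q -catA /= cat_rcons.
rewrite /ucycle; apply/andP; split.
  move: xq; rewrite def_q' cat_path => /andP[xp _].
  by rewrite [path.cycle _ _]/= rcons_path xp last_cat /= last_rcons e_sym.
by move: xq_uniq; rewrite def_q' -cat_cons cat_uniq => /andP[].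
Qed.

Lemma exists_longest_cycle : exists s, longest_cycle e s.
Proof.
pose Q m := `[< exists2 s, graph_cycle e s & size s = m >].
have Q0 : exists m, Q m.
  by have [s s_cyc] := exists_cycle; exists (size s); apply/asboolP; exists s.
have Q_le m : Q m -> m <= #|T|.
  move/asboolP=> [s [_ /andP[_ s_uniq]] <-].
  by rewrite -(card_uniqP s_uniq) max_card.
have [m /asboolP[s s_cyc s_size] m_max] := ex_maxnP Q0 Q_le.
by exists s; split=> // z z_cyc; rewrite s_size m_max //; apply/asboolP; exists z.
Qed.

Lemma longest_cycles_meet c0 c1 : longest_cycle e c0 -> longest_cycle e c1 ->
  exists2 t, t \in c0 & t \in c1.
Proof.
move=> c0_long c1_long; apply: contrapT => disj.
pose c b := if b then c1 else c0.
have c_long b : longest_cycle e (c b) by case: b.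
have excl : {in c0, forall t, t \notin c1}.
  by move=> t t0; apply/negP => t1; apply: disj; exists t.
have I0 : #|[set t in c false] :&: [set t in c true]| = 0.
  by apply: eq_card0 => t; rewrite !inE; case: (boolP (t \in c0)) => // /excl/negPf.
have outside b (S : {set T}) : #|S| <= 1 -> exists2 t, t \in c b & t \notin S.
  move=> S1; apply: contrapT => none; case: (c_long b) => -[c_gt2 /andP[_ c_uniq]] _.
  have : #|c b| <= #|S|.
    by apply: subset_leq_card; apply/subsetP => t tc; apply: contrapT => /negP tS; apply: none; exists t.
  by rewrite (card_uniqP c_uniq); move: c_gt2 S1; lia.
have [X [f [P [cXfP X2]]]] : exists (X : {set T}) f P, linkage e c [in X] f P /\
    2 <= #|X| + #|[set t in c false] :&: [set t in c true]|.
  apply: menger_linkage => S sepS; rewrite leqNgt; apply/negP; rewrite ltnS => S1.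
  have [x xc xS] := outside false S S1; have [y yc yS] := outside true S S1.
  have [p [p_path last_p pS]] : exists p, [/\ path e x p, last x p = y & ~~ has [in S] (x :: p)].
    case: (set_0Vmem S) => [->|[r rS]].
      case/connectP: (e_conn.2 x y) => p p_path ->; exists p; split=> //.
      by apply/hasPn => t _; rewrite inE.
    have def_S : S = [set r].
      by apply/esym/eqP; rewrite eqEcard sub1set rS cards1.
    have /connectP[p p_path ->] : connect (avoiding r) x y.
      by apply: no_cut_vertex; rewrite -in_set1 -def_S.
    exists p; split=> //; first by apply: sub_path p_path => ? ? /andP[].
    apply/hasPn => t; rewrite inE /= def_S in_set1.
    case/predU1P=> [->|]; first by rewrite -in_set1 -def_S.
    elim: p x p_path {xc xS} => //= y' p IHp x /andP[/and3P[_ _ y'r] p_path].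
    by rewrite inE => /predU1P[->//|]; apply: IHp p_path.
  move: pS; rewrite (sepS y) ?inE //.
  by rewrite /= inE xc p_path last_p eqxx.
rewrite I0 addn0 in X2.
have /card_gt1P[x [y [xX yX xy]]] := X2.
exact: (linked_cycles_meet e_sym c_long cXfP xX yX xy).
Qed.

Lemma longest_cycle_meets_separator c0 c1 z S :
  longest_cycle e c0 -> longest_cycle e c1 -> longest_cycle e z ->
  separates e [set t in c0] [set t in c1] S -> exists2 t, t \in z & t \in S.
Proof.
move=> c0_long c1_long z_long sepS.
have [x xz x0] := longest_cycles_meet z_long c0_long.
have [y yz y1] := longest_cycles_meet z_long c1_long.
case/rot_to: (xz) => i p rot_z.
have y_p : y \in x :: p by rewrite -rot_z mem_rot.
have p_path : path e x p.
  case: z_long => -[_ /andP[z_cyc _]] _; move: z_cyc; rewrite -(rot_cycle i) rot_z /=.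
  by rewrite rcons_path => /andP[].
have [p1 [p2 def_p]] : exists p1 p2, x :: p = rcons p1 y ++ p2.
  by case/splitPr: y_p => p1 p2; exists p1, p2; rewrite cat_rcons.
have w : walk e [set t in c0] (last x p) (x :: p) by rewrite /= inE x0 p_path eqxx.
rewrite def_p in w; have := sepS y _ _ (walk_prefix w); rewrite inE => /(_ y1)/hasP[t tp tS].
by exists t => //; rewrite -(mem_rot i) rot_z def_p mem_cat tp.
Qed.

End VertexTransitive.

(** * Averaging over the automorphism group *)

Section Averaging.

Variables (T : finType) (e : rel T).
Hypothesis e_trans : vertex_transitive e.

Definition automorphisms : {set {perm T}} :=
  [set g : {perm T} | [forall x, forall y, e (g x) (g y) == e x y]].

Lemma automorphismsP g : reflect (graph_automorphism e g) (g \in automorphisms).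
Proof.
rewrite inE; apply: (iffP forallP) => [auto x y|auto x].
  by have /forallP/(_ y)/eqP := auto x.
by apply/forallP => y; rewrite auto.
Qed.

Definition transporters x y := [set g in automorphisms | g x == y].

Lemma card_transporters_le x y x' y' : #|transporters x y| <= #|transporters x' y'|.
Proof.
have [a a_auto ax] := e_trans x' x.
have [b b_auto by_] := e_trans y y'.
have inj : injective (fun g : {perm T} => (a * g * b)%g).
  by move=> g h /mulIg/mulgI.
rewrite -(card_imset _ inj); apply/subset_leq_card/subsetP => _ /imsetP[g + ->].
rewrite [g \in _]inE => /andP[/automorphismsP g_auto /eqP gx].
rewrite inE; apply/andP; split; last by rewrite 2!permM ax gx by_.
by apply/automorphismsP => s t; rewrite !permM b_auto g_auto a_auto.
Qed.

Lemma card_transporters x y x' y' : #|transporters x y| = #|transporters x' y'|.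
Proof. by apply/eqP; rewrite eqn_leq !card_transporters_le. Qed.

Lemma card_automorphisms x y : #|T| * #|transporters x y| = #|automorphisms|.
Proof.
rewrite -[#|automorphisms|]sum1_card (partition_big (fun g : {perm T} => g x) predT) //=.
rewrite -sum_nat_const; apply: eq_bigr => z _.
by rewrite sum1dep_card (card_transporters x y x z); apply: eq_card => g; rewrite !inE.
Qed.

Lemma automorphisms_gt0 : 0 < #|automorphisms|.
Proof. by apply/card_gt0P; exists 1%g; apply/automorphismsP => x y; rewrite !perm1. Qed.

Lemma sum_translates (A B : {set T}) x y :
  \sum_(g in automorphisms) #|[set a in A | g a \in B]| = #|A| * #|B| * #|transporters x y|.
Proof.
transitivity (\sum_(a in A) \sum_(b in B) #|transporters a b|); last first.
  rewrite -mulnA -sum_nat_const; apply: eq_bigr => a _.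
  by rewrite -sum_nat_const; apply: eq_bigr => b _; apply: card_transporters.
transitivity (\sum_(g in automorphisms) \sum_(a in A) \sum_(b in B) (g a == b)).
  apply: eq_bigr => g _; rewrite -sum1dep_card big_mkcondr; apply: eq_bigr => a _.
  case: ifP => gB.
    by rewrite (bigD1 (g a)) //= eqxx big1 // => b /andP[_ /negPf]; rewrite eq_sym => ->.
  by rewrite big1 // => b bB; case: eqP => // gab; rewrite gab bB in gB.
rewrite exchange_big; apply: eq_bigr => a _; rewrite exchange_big; apply: eq_bigr => b _.
by rewrite -big_mkcondr sum1dep_card; apply: eq_card => g; rewrite !inE.
Qed.

Lemma small_translate (A B : {set T}) : 0 < #|T| ->
  exists2 g, g \in automorphisms & #|T| * #|[set a in A | g a \in B]| <= #|A| * #|B|.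
Proof.
case/card_gt0P=> x _; apply: contrapT => none.
have large g : g \in automorphisms -> #|A| * #|B| < #|T| * #|[set a in A | g a \in B]|.
  by move=> gA; rewrite ltnNge; apply/negP => le; apply: none; exists g.
have : \sum_(g in automorphisms) (#|A| * #|B|).+1 <=
    \sum_(g in automorphisms) #|T| * #|[set a in A | g a \in B]| by apply: leq_sum.
rewrite -big_distrr (sum_translates A B x x) sum_nat_const /=.
have := automorphisms_gt0; rewrite -(card_automorphisms x x) => gt0.
by rewrite [#|A| * #|B| * _]mulnC mulnA leq_pmul2l // ltnn.
Qed.

Lemma hitting_translates (A B : {set T}) : 0 < #|T| ->
  (forall g, g \in automorphisms -> 0 < #|[set a in A | g a \in B]|) -> #|T| <= #|A| * #|B|.
Proof.
case/card_gt0P=> x _ hit; have gt0 := automorphisms_gt0; rewrite -(card_automorphisms x x) muln_gt0 in gt0.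
case/andP: gt0 => _ N_gt0.
rewrite -(leq_pmul2r N_gt0) -(sum_translates A B) card_automorphisms -sum1_card.
exact: leq_sum.
Qed.

End Averaging.

(** * The main bound *)

Lemma longest_cycle_translate (T : finType) (e : rel T) (g : {perm T}) c :
  graph_automorphism e g -> longest_cycle e c -> longest_cycle e (map g c).
Proof.
move=> g_auto [[c_gt2 /andP[c_cyc c_uniq]] c_max]; split; last first.
  by move=> z /c_max; rewrite size_map.
split; first by rewrite size_map.
rewrite /ucycle map_inj_uniq ?c_uniq ?andbT; last exact: perm_inj.
by rewrite cycle_map; apply: sub_cycle c_cyc => x y; rewrite /= g_auto.
Qed.

Lemma minimal_separator (T : finType) (e : rel T) (A B : {set T}) :
  exists2 S, separates e A B S & forall S', separates e A B S' -> #|S| <= #|S'|.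
Proof.
pose Q m := `[< exists2 S, separates e A B S & #|S| = m >].
have Q_B : exists m, Q m.
  exists #|B|; apply/asboolP; exists B => // x p xB /walk_last[p' ->].
  by rewrite has_rcons /= xB.
have [m /asboolP[S sepS Sm] m_min] := ex_minnP Q_B.
by exists S => // S' sepS'; rewrite Sm m_min //; apply/asboolP; exists S'.
Qed.

Section Bound.
Local Open Scope ring_scope.

Lemma thirteenth_power_bound (R : realFieldType) (n L k m x d : R) :
  0 <= n -> 0 <= L -> 1 <= k -> 0 <= m -> 0 <= x -> 0 <= d ->
  n * k <= L * L -> n <= L * m -> m <= x + k -> x ^+ 5 <= d * (k + 1) ^+ 8 ->
  n ^+ 13 <= (2 ^+ 13 * d + 2 ^+ 5) * L ^+ 21.
Proof.
move=> n0 L0 k1 m0 x0 d0 nk nm mx x5; have k0 : 0 <= k by lra.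
have m5 : m ^+ 5 <= (2 ^+ 13 * d + 2 ^+ 5) * k ^+ 8.
  have [xk|kx] := lerP x k.
    apply: le_trans (_ : (2 * k) ^+ 5 <= _).
      by apply: lerXn2r; rewrite ?nnegrE ?mulr_ge0 //; lra.
    apply: le_trans (_ : 2 ^+ 5 * k ^+ 8 <= _).
      by rewrite exprMn; apply: ler_wpM2l; rewrite ?exprn_ge0 //; apply: ler_weXn2l.
    by apply: ler_wpM2r; rewrite ?exprn_ge0 // lerDr mulr_ge0 ?exprn_ge0.
  apply: le_trans (_ : (2 * x) ^+ 5 <= _).
    by apply: lerXn2r; rewrite ?nnegrE ?mulr_ge0 //; lra.
  rewrite exprMn; apply: le_trans (_ : 2 ^+ 5 * (d * (2 * k) ^+ 8) <= _).
    apply: ler_wpM2l; rewrite ?exprn_ge0 //; apply: le_trans x5 _.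
    by apply: ler_wpM2l => //; apply: lerXn2r; rewrite ?nnegrE ?mulr_ge0 ?addr_ge0 //; lra.
  have -> : 2 ^+ 5 * (d * (2 * k) ^+ 8) = 2 ^+ 13 * d * k ^+ 8 by ring.
  by apply: ler_wpM2r; rewrite ?exprn_ge0 // lerDl exprn_ge0.
set b := 2 ^+ 13 * d + 2 ^+ 5 in m5 *.
have b0 : 0 <= b by rewrite addr_ge0 ?mulr_ge0 ?exprn_ge0.
have n5 : n ^+ 5 <= L ^+ 5 * (b * k ^+ 8).
  apply: le_trans (_ : (L * m) ^+ 5 <= _); first by apply: lerXn2r; rewrite ?nnegrE ?mulr_ge0.
  by rewrite exprMn; apply: ler_wpM2l; rewrite ?exprn_ge0.
have -> : n ^+ 13 = n ^+ 5 * n ^+ 8 by rewrite -exprD.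
apply: le_trans (_ : L ^+ 5 * (b * k ^+ 8) * n ^+ 8 <= _); first by apply: ler_wpM2r; rewrite ?exprn_ge0.
have -> : L ^+ 5 * (b * k ^+ 8) * n ^+ 8 = b * L ^+ 5 * (n * k) ^+ 8 by ring.
have -> : b * L ^+ 21 = b * L ^+ 5 * (L * L) ^+ 8 by ring.
apply: ler_wpM2l; first by rewrite mulr_ge0 ?exprn_ge0.
by apply: lerXn2r; rewrite ?nnegrE ?mulr_ge0.
Qed.

End Bound.

Lemma long_cycle (R : realFieldType) (T : finType) (e : rel T) : simple_graph e -> connected_graph e ->
  vertex_transitive e -> 2 < #|T| ->
  exists2 c, graph_cycle e c &
    (#|T|%:R ^+ 13 <= (2 ^+ 13 * 2 ^+ 22 + 2 ^+ 5) * (size c)%:R ^+ 21 :> R)%R.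
Proof.
move=> e_simple e_conn e_trans T_ge3.
have [c c_long] := exists_longest_cycle e_simple e_conn e_trans T_ge3.
exists c; first by case: c_long.
have T_gt0 : 0 < #|T| by apply: leq_trans T_ge3.
pose C : {set T} := [set t in c].
have C_size : #|C| = size c.
  by rewrite cardsE; apply/card_uniqP; case: c_long => -[_ /andP[]].
have [g /automorphismsP g_auto g_small] := small_translate e_trans C C T_gt0.
have gc_long := longest_cycle_translate g_auto c_long.
pose cc b := if b then map g c else c.
have cc_long b : longest_cycle e (cc b) by case: b.
pose I := [set t in cc false] :&: [set t in cc true].
have I_le : #|T| * #|I| <= size c * size c.
  rewrite -C_size; apply: leq_trans g_small; rewrite leq_mul2l; apply/orP; right.
  rewrite -[leqRHS](card_imset _ (@perm_inj _ g)); apply/subset_leq_card/subsetP => t.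
  rewrite /I !inE /cc => /andP[tc /mapP[a ac def_t]]; apply/imsetP; exists a => //.
  by rewrite !inE ac -def_t.
have I_gt0 : 0 < #|I|.
  have [t tc tgc] := longest_cycles_meet e_simple e_conn e_trans T_ge3 c_long gc_long.
  by apply/card_gt0P; exists t; rewrite /I !inE tc.
have [S sepS S_min] := minimal_separator e [set t in cc false] [set t in cc true].
have [X [f [P [cXfP S_le]]]] := menger_linkage S_min.
have T_le : #|T| <= size c * #|S|.
  rewrite -C_size; apply: (hitting_translates e_trans T_gt0) => h /automorphismsP h_auto.
  have hc_long := longest_cycle_translate h_auto c_long.
  have [t /mapP[a ac ->] tS] :=
    longest_cycle_meets_separator e_simple e_conn e_trans T_ge3 c_long gc_long hc_long sepS.
  by apply/card_gt0P; exists a; rewrite !inE ac.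
have e_sym : symmetric e by case: e_simple.
have X_le := linkage_bound e_sym cc_long cXfP R.
apply: (@thirteenth_power_bound _ _ _ #|I|%:R #|S|%:R #|X|%:R).
- exact: ler0n.
- exact: ler0n.
- by rewrite ler1n.
- exact: ler0n.
- exact: ler0n.
- by rewrite exprn_ge0.
- by rewrite -!natrM ler_nat.
- by rewrite -!natrM ler_nat.
- by rewrite -natrD ler_nat.
- apply: le_trans X_le _; rewrite natr1; set k := #|I|.+1.
  suff -> : #|[set t | (t \in cc false) && (t \in cc true)]|.+1 = k by exact: lexx.
  by congr _.+1; apply: eq_card => t; rewrite !inE.
Qed.

Local Open Scope ring_scope.

Theorem theorem1p1 (R : realType) :
  exists2 c : R, 0 < c &
    forall (T : finType) (e : rel T),
      simple_graph e -> connected_graph e -> vertex_transitive e ->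
      (3 <= #|T|)%N ->
      exists2 s : seq T, graph_cycle e s &
        c * #|T|%:R `^ (13%:R / 21%:R) <= (size s)%:R.
Proof.
pose b : R := 2 ^+ 13 * 2 ^+ 22 + 2 ^+ 5.
have b_gt0 : 0 < b by rewrite addr_gt0 ?mulr_gt0 ?exprn_gt0.
exists (b `^ (21%:R^-1))^-1; first by rewrite invr_gt0 powR_gt0.
move=> T e e_simple e_conn e_trans T_ge3.
have [s s_cyc s_long] := long_cycle R e_simple e_conn e_trans T_ge3.
exists s => //; rewrite ler_pdivrMl ?powR_gt0 //.
have root21 (x : R) : 0 <= x -> (x ^+ 21) `^ (21%:R^-1) = x.
  by move=> x0; rewrite -powR_mulrn // -powRrM mulfV ?powRr1 // pnatr_eq0.
have b_ge0 := ltW b_gt0.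
rewrite -[X in _ <= _ * X]root21 ?ler0n // -powRM ?exprn_ge0 //.
rewrite powRrM powR_mulrn ?ler0n //.
by apply: ge0_ler_powR; rewrite ?nnegrE ?invr_ge0 ?mulr_ge0 ?exprn_ge0.
Qed.
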